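(* Let $n$ be a positive integer, let $q\in\mathbb{C}^*$ be not a root of unity, and let $\mathfrak{h}_n(q)$ be the $q$-Heisenberg algebra over $K=\mathbb{C}$, with each generator $x_i,y_i,z_i$ placed in degree $1$. Then the group of graded $K$-algebra automorphisms of $\mathfrak{h}_n(q)$ is isomorphic to the semidirect product $$(\mathbb{C}^* )^{2n}\rtimes S_n,$$ where $S_n$ acts by permuting the indices $\{1,\dots,n\}$ simultaneously on the triples $(x_i,y_i,z_i)$, and $(\mathbb{C}^* )^{2n}$, with elements written $(A_1,\dots,A_n,B_1,\dots,B_n)$, acts by the rescalings $x_i\mapsto A_ix_i$, $y_i\mapsto B_iy_i$, $z_i\mapsto A_iB_iz_i$.
   Context: The $q$-Heisenberg algebra $\mathfrak{h}_n(q)$ is the unital associative $K$-algebra generated by $x_i,y_i,z_i$ ($1\le i\le n$) subject to the relations: $x_ix_j=x_jx_i$, $y_iy_j=y_jy_i$, $z_iz_j=z_jz_i$ for $1\le i<j\le n$; $x_iz_i=q\,z_ix_i$, $y_iz_i=q^{-1}z_iy_i$, $x_iy_i=q^{-1}y_ix_i+z_i$ for $1\le i\le n$; and $x_iy_j=y_jx_i$, $x_iz_j=z_jx_i$, $y_iz_j=z_jy_i$ for $i\ne j$. It has the PBW $K$-basis consisting of the monomials $z_1^{a_1}\cdots z_n^{a_n}y_1^{b_1}\cdots y_n^{b_n}x_1^{c_1}\cdots x_n^{c_n}$ with $a_i,b_i,c_i\in\mathbb{N}$. For $d\ge 0$, $\mathfrak{h}_n(q)_d$ denotes the $K$-span of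 the PBW monomials of total degree $\sum_i(a_i+b_i+c_i)=d$, so that $\mathfrak{h}_n(q)=\bigoplus_{d\ge0}\mathfrak{h}_n(q)_d$ as a vector space. A $K$-algebra automorphism $\phi$ of $\mathfrak{h}_n(q)$ is called graded if $\phi(\mathfrak{h}_n(q)_d)\subseteq\mathfrak{h}_n(q)_d$ for all $d\ge0$. The group $S_n$ acts on $(\mathbb{C}^* )^{2n}=(\mathbb{C}^* )^n\times(\mathbb{C}^* )^n$ by permuting the index $i$ simultaneously in the coordinates $A_i$ and $B_i$. *)

(* Defs.v *)
From HB Require Import structures.
From mathcomp Require Import all_boot all_order all_algebra all_fingroup.
From mathcomp Require Import boolp classical_sets.
From mathcomp Require Import monalg.
From mathcomp Require Import generic_quotient ring_quotient.

Set Implicit Arguments.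
Unset Strict Implicit.
Unset Printing Implicit Defensive.

Import GRing.Theory.
Local Open Scope ring_scope.
Local Open Scope quotient_scope.

Lemma malg_scaleAr (K : comNzRingType) (M : monomType) (c : K)
    (u v : {malg K[M]}) : c *: (u * v) = u * (c *: v).
Proof.
have commc : c%:MP * u = u * c%:MP.
  rewrite mul_malgC malgM_def fgmulgU; apply: eq_bigr => k _.
  by rewrite mulm1 mulrC.
by rewrite -mul_malgC -[c *: v]mul_malgC !mulrA commc.
Qed.

Definition heis_gen (n : nat) : Type := ('I_n + 'I_n + 'I_n)%type.
HB.instance Definition _ n := Choice.on (heis_gen n).

Section Relations.
Variables (K : fieldType) (n : nat) (q : K) (A : lalgType K).
Variables x y z : 'I_n -> A.

(* [heis_rel u v]: the relation u = v is one of the defining relations. *)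
Inductive heis_rel : A -> A -> Prop :=
| rel_xx (i j : 'I_n) of (i < j)%N : heis_rel (x i * x j) (x j * x i)
| rel_yy (i j : 'I_n) of (i < j)%N : heis_rel (y i * y j) (y j * y i)
| rel_zz (i j : 'I_n) of (i < j)%N : heis_rel (z i * z j) (z j * z i)
| rel_xz (i : 'I_n) : heis_rel (x i * z i) (q *: (z i * x i))
| rel_yz (i : 'I_n) : heis_rel (y i * z i) (q^-1 *: (z i * y i))
| rel_xy (i : 'I_n) : heis_rel (x i * y i) (q^-1 *: (y i * x i) + z i)
| rel_xyC (i j : 'I_n) of i != j : heis_rel (x i * y j) (y j * x i)
| rel_xzC (i j : 'I_n) of i != j : heis_rel (x i * z j) (z j * x i)
| rel_yzC (i j : 'I_n) of i != j : heis_rel (y i * z j) (z j * y i).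

Lemma heis_rel_const (e : A -> K) :
  {morph e : u v / u + v} -> {morph e : u v / u * v} ->
  (forall c u, e (c *: u) = c * e u) ->
  (forall i, [/\ e (x i) = 0, e (y i) = 0 & e (z i) = 0]) ->
  forall u v, heis_rel u v -> e u = 0 /\ e v = 0.
Proof.
move=> eD eM eZ e0.
have ex i : e (x i) = 0 by have [] := e0 i.
have ey i : e (y i) = 0 by have [] := e0 i.
have ez i : e (z i) = 0 by have [] := e0 i.
by move=> u v; case=> *; rewrite ?eD ?eZ !eM !(ex, ey, ez) !mulr0 ?addr0.
Qed.

End Relations.

Lemma heis_rel_lift (K : fieldType) (n : nat) (q : K) (A B : lalgType K)
    (x y z : 'I_n -> A) (g : A -> B) :
  {morph g : u v / u + v} -> {morph g : u v / u * v} ->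
  (forall c u, g (c *: u) = c *: g u) ->
  forall a b, heis_rel q (g \o x) (g \o y) (g \o z) a b ->
  exists u v, [/\ heis_rel q x y z u v, a = g u & b = g v].
Proof.
move=> gD gM gZ a b; case=> [i j ij|i j ij|i j ij|i|i|i|i j ij|i j ij|i j ij].
- by exists (x i * x j), (x j * x i); rewrite !gM; split=> //; constructor.
- by exists (y i * y j), (y j * y i); rewrite !gM; split=> //; constructor.
- by exists (z i * z j), (z j * z i); rewrite !gM; split=> //; constructor.
- by exists (x i * z i), (q *: (z i * x i)); rewrite gZ !gM; split=> //;
    constructor.
- by exists (y i * z i), (q^-1 *: (z i * y i)); rewrite gZ !gM; split=> //;
    constructor.
- by exists (x i * y i), (q^-1 *: (y i * x i) + z i); rewrite gD gZ !gM;
    split=> //; constructor.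
- by exists (x i * y j), (y j * x i); rewrite !gM; split=> //; constructor.
- by exists (x i * z j), (z j * x i); rewrite !gM; split=> //; constructor.
- by exists (y i * z j), (z j * y i); rewrite !gM; split=> //; constructor.
Qed.

Section HeisenbergAlgebra.
Variables (K : fieldType) (n : nat) (q : K).

Definition free_alg : Type := {malg K[{fmonom heis_gen n}]}.
HB.instance Definition _ := GRing.Lalgebra.on free_alg.

Definition free_x (i : 'I_n) : free_alg := << fmu (inl (inl i) : heis_gen n) >>.
Definition free_y (i : 'I_n) : free_alg := << fmu (inl (inr i) : heis_gen n) >>.
Definition free_z (i : 'I_n) : free_alg := << fmu (inr i : heis_gen n) >>.

Definition free_rel : free_alg -> free_alg -> Prop :=
  heis_rel q free_x free_y free_z.

(* The two-sided ideal generated by the differences u - v of the relations. *)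
Inductive heis_ideal : free_alg -> Prop :=
| ideal_rel u v of free_rel u v : heis_ideal (u - v)
| ideal_0 : heis_ideal 0
| ideal_D u v of heis_ideal u & heis_ideal v : heis_ideal (u + v)
| ideal_Ml a u of heis_ideal u : heis_ideal (a * u)
| ideal_Mr a u of heis_ideal u : heis_ideal (u * a).

Definition in_heis_ideal : pred free_alg := fun u => `[< heis_ideal u >].

Fact heis_ideal_zmod_closed : zmod_closed in_heis_ideal.
Proof.
split; first by apply/asboolP; exact: ideal_0.
move=> u v /asboolP iu /asboolP iv; apply/asboolP.
by apply: ideal_D => //; rewrite -mulN1r; apply: ideal_Ml.
Qed.

HB.instance Definition _ :=
  GRing.isZmodClosed.Build free_alg in_heis_ideal heis_ideal_zmod_closed.

Lemma heis_idealP u : reflect (heis_ideal u) (u \in in_heis_ideal).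
Proof. exact: asboolP. Qed.

Definition heis_zmod_ideal : zmodClosed free_alg :=
  GRing.ZmodClosed.clone free_alg in_heis_ideal _.

Definition heis : Type := Quotient.quot heis_zmod_ideal.
HB.instance Definition _ := GRing.Zmodule.on heis.
HB.instance Definition _ := EqQuotient.on heis.

(* The quotient map and the operations below are locked, so that unification
   does not compute in the free algebra. *)
Fact heis_key : unit. Proof. by []. Qed.

Definition heis_pi : free_alg -> heis :=
  locked_with heis_key \pi_(Quotient.quot heis_zmod_ideal).

Lemma heis_piE u : heis_pi u = \pi_(Quotient.quot heis_zmod_ideal) u.
Proof. by rewrite /heis_pi unlock. Qed.

Lemma heis_piP (u v : free_alg) :
  heis_pi u = heis_pi v <-> heis_ideal (u - v).
Proof.
rewrite !heis_piE.
split=> [/eqP|iuv]; first by rewrite -Quotient.idealrBE => /heis_idealP.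
by apply/eqP; rewrite -Quotient.idealrBE; apply/heis_idealP.
Qed.

Lemma heis_pi_surj (u : heis) : {v | u = heis_pi v}.
Proof. by exists (repr u); rewrite heis_piE reprK. Qed.

Definition heis_one : heis := heis_pi 1.
Definition heis_mul : heis -> heis -> heis :=
  locked_with heis_key (fun u v => heis_pi (repr u * repr v)).
Definition heis_scale : K -> heis -> heis :=
  locked_with heis_key (fun c u => heis_pi (c *: repr u)).

Lemma repr_pi u : heis_ideal (repr (heis_pi u) - u).
Proof. by apply/heis_piP; rewrite !heis_piE reprK. Qed.

Lemma heis_piD u v : heis_pi (u + v) = heis_pi u + heis_pi v.
Proof. by rewrite !heis_piE raddfD. Qed.

Lemma heis_piM u v : heis_pi (u * v) = heis_mul (heis_pi u) (heis_pi v).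
Proof.
rewrite /heis_mul unlock; apply/esym/heis_piP; set u' := repr _; set v' := repr _.
have -> : u' * v' - u * v = (u' - u) * v' + u * (v' - v).
  by rewrite mulrBl mulrBr addrA subrK.
by apply: ideal_D; [apply: ideal_Mr | apply: ideal_Ml]; apply: repr_pi.
Qed.

Lemma free_scaleM (c : K) (u : free_alg) : c *: u = (c *: 1) * u.
Proof. by rewrite -scalerAl mul1r. Qed.

Lemma heis_piZ c u : heis_pi (c *: u) = heis_scale c (heis_pi u).
Proof.
rewrite /heis_scale unlock; apply/esym/heis_piP; rewrite -scalerBr free_scaleM.
by apply: ideal_Ml; apply: repr_pi.
Qed.

Fact heis_mulA : associative heis_mul.
Proof.
move=> u v w; case: (heis_pi_surj u) (heis_pi_surj v) (heis_pi_surj w).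
by move=> {}u -> [{}v ->] [{}w ->]; rewrite -!heis_piM mulrA.
Qed.

Fact heis_mul1 : left_id heis_one heis_mul.
Proof. by move=> u; have [v ->] := heis_pi_surj u; rewrite -heis_piM mul1r. Qed.

Fact heis_mulr1 : right_id heis_one heis_mul.
Proof. by move=> u; have [v ->] := heis_pi_surj u; rewrite -heis_piM mulr1. Qed.

Fact heis_mulDl : left_distributive heis_mul +%R.
Proof.
move=> u v w; case: (heis_pi_surj u) (heis_pi_surj v) (heis_pi_surj w).
move=> {}u -> [{}v ->] [{}w ->].
by rewrite -heis_piD -!heis_piM -heis_piD mulrDl.
Qed.

Fact heis_mulDr : right_distributive heis_mul +%R.
Proof.
move=> u v w; case: (heis_pi_surj u) (heis_pi_surj v) (heis_pi_surj w).
move=> {}u -> [{}v ->] [{}w ->].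
by rewrite -heis_piD -!heis_piM -heis_piD mulrDr.
Qed.

Definition free_const (u : free_alg) : K :=
  mcoeff (@mone {fmonom heis_gen n}) u.

(* The relations have no constant term, so 1 is not in the ideal. *)
Lemma heis_ideal_const (u : free_alg) : heis_ideal u -> free_const u = 0.
Proof.
have cM (v w : free_alg) :
    free_const (v * w) = free_const v * free_const w.
  exact: (rmorphM (mcoeff (@mone {fmonom heis_gen n})
                     : {malg K[{fmonom heis_gen n}]} -> K)).
have cB (v w : free_alg) : free_const (v - w) = free_const v - free_const w.
  exact: mcoeffB.
have cD (v w : free_alg) : free_const (v + w) = free_const v + free_const w.
  exact: mcoeffD.
have cZ c (v : free_alg) : free_const (c *: v) = c * free_const v.
  exact: mcoeffZ.
have cU (k : heis_gen n) : free_const << fmu k >> = 0.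
  by rewrite /free_const mcoeffU1 -fdeg_eq0 fdegU.
elim=> [v w r||v w _ v0 _ w0|a v _ v0|a v _ v0].
- have [] := heis_rel_const cD cM cZ _ r.
    by move=> i; split; apply: cU.
  by move=> v0 w0; rewrite cB v0 w0 subrr.
- exact: mcoeff0.
- by rewrite cD v0 w0 addr0.
- by rewrite cM v0 mulr0.
- by rewrite cM v0 mul0r.
Qed.

Fact heis_one_neq0 : heis_one != 0.
Proof.
have -> : 0 = heis_pi 0 :> heis by rewrite heis_piE raddf0.
apply/eqP => /heis_piP /heis_ideal_const.
by rewrite subr0 /free_const mcoeff1 eqxx => /eqP; rewrite oner_eq0.
Qed.

HB.instance Definition _ := GRing.Zmodule_isNzRing.Build heis
  heis_mulA heis_mul1 heis_mulr1 heis_mulDl heis_mulDr heis_one_neq0.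

Fact heis_scaleA c d u : heis_scale c (heis_scale d u) = heis_scale (c * d) u.
Proof. by have [v ->] := heis_pi_surj u; rewrite -!heis_piZ scalerA. Qed.

Fact heis_scale1 : left_id 1 heis_scale.
Proof. by move=> u; have [v ->] := heis_pi_surj u; rewrite -heis_piZ scale1r. Qed.

Fact heis_scaleDr : right_distributive heis_scale +%R.
Proof.
move=> c u v; case: (heis_pi_surj u) (heis_pi_surj v) => {}u -> [{}v ->].
by rewrite -heis_piD -!heis_piZ -heis_piD scalerDr.
Qed.

Fact heis_scaleDl u : {morph heis_scale^~ u : c d / c + d}.
Proof.
move=> c d; have [v ->] := heis_pi_surj u.
by rewrite -!heis_piZ -heis_piD scalerDl.
Qed.

HB.instance Definition _ := GRing.Zmodule_isLmodule.Build K heis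
  heis_scaleA heis_scale1 heis_scaleDr heis_scaleDl.

Fact heis_scaleAl (c : K) (u v : heis) : c *: (u * v) = (c *: u) * v.
Proof.
case: (heis_pi_surj u) (heis_pi_surj v) => {}u -> [{}v ->].
rewrite -[LHS]/(heis_scale c (heis_mul _ _)).
by rewrite -[RHS]/(heis_mul (heis_scale c _) _) -heis_piM -!heis_piZ -heis_piM
  scalerAl.
Qed.

HB.instance Definition _ := GRing.Lmodule_isLalgebra.Build K heis heis_scaleAl.

Fact heis_scaleAr (c : K) (u v : heis) : c *: (u * v) = u * (c *: v).
Proof.
case: (heis_pi_surj u) (heis_pi_surj v) => {}u -> [{}v ->].
rewrite -[LHS]/(heis_scale c (heis_mul _ _)).
by rewrite -[RHS]/(heis_mul _ (heis_scale c _)) -heis_piM -!heis_piZ -heis_piM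
  malg_scaleAr.
Qed.

HB.instance Definition _ := GRing.Lalgebra_isAlgebra.Build K heis heis_scaleAr.

End HeisenbergAlgebra.

HB.lock Definition heis_x (K : fieldType) (n : nat) (q : K) (i : 'I_n) :
  heis n q := heis_pi q (free_x K i).
HB.lock Definition heis_y (K : fieldType) (n : nat) (q : K) (i : 'I_n) :
  heis n q := heis_pi q (free_y K i).
HB.lock Definition heis_z (K : fieldType) (n : nat) (q : K) (i : 'I_n) :
  heis n q := heis_pi q (free_z K i).

Lemma heis_relP (K : fieldType) (n : nat) (q : K) (u v : heis n q) :
  heis_rel q (heis_x q) (heis_y q) (heis_z q) u v -> u = v.
Proof.
rewrite heis_x.unlock heis_y.unlock heis_z.unlock.
case/(heis_rel_lift (@heis_piD _ _ q) (@heis_piM _ _ q) (@heis_piZ _ _ q)).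
by move=> a [b [r -> ->]]; apply/heis_piP; apply: ideal_rel.
Qed.

Section Grading.
Variables (K : fieldType) (n : nat) (q : K).
Local Notation H := (heis n q).

Definition expo : Type := {ffun 'I_n -> nat}.

(* The exponents are listed in the order (a, b, c) of z, y, x. *)
Definition pbw (m : expo * expo * expo) : H :=
  (\prod_(i < n) heis_z q i ^+ m.1.1 i) * (\prod_(i < n) heis_y q i ^+ m.1.2 i)
    * (\prod_(i < n) heis_x q i ^+ m.2 i).

Definition pbw_deg (m : expo * expo * expo) : nat :=
  (\sum_(i < n) (m.1.1 i + m.1.2 i + m.2 i))%N.

(* [heis_deg d u]: u lies in the K-span of the PBW monomials of total
   degree d. *)
Definition heis_deg (d : nat) (u : H) : Prop :=
  exists2 s : seq (K * (expo * expo * expo)),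
    all (fun t => pbw_deg t.2 == d) s & u = \sum_(t <- s) t.1 *: pbw t.2.

(* Invariance is only required of f; see [heis_deg_preim] for its inverse. *)
Definition is_graded_aut (f : H -> H) : Prop :=
  [/\ linear f, monoid_morphism f, bijective f &
      forall d u, heis_deg d u -> heis_deg d (f u)].

Record graded_aut : Type := GradedAut {
  graded_aut_fun :> H -> H;
  graded_autP_subproof : `[< is_graded_aut graded_aut_fun >] }.

HB.instance Definition _ := [isSub for graded_aut_fun].
HB.instance Definition _ := [Choice of graded_aut by <:].

Lemma graded_autP (f : graded_aut) : is_graded_aut f.
Proof. exact/asboolP/graded_autP_subproof. Qed.

Lemma graded_aut_eq (f g : graded_aut) : f =1 g -> f = g.
Proof. by move=> fg; apply/val_inj/funext. Qed.

Lemma heis_deg0 d : heis_deg d 0.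
Proof. by exists [::]; rewrite ?big_nil. Qed.

Lemma heis_degD d u v : heis_deg d u -> heis_deg d v -> heis_deg d (u + v).
Proof.
move=> [s sd ->] [t td ->]; exists (s ++ t); first by rewrite all_cat sd td.
by rewrite big_cat.
Qed.

Lemma heis_degZ d c u : heis_deg d u -> heis_deg d (c *: u).
Proof.
move=> [s sd ->]; exists [seq (c * t.1, t.2) | t <- s].
  by rewrite all_map.
by rewrite big_map scaler_sumr; apply: eq_bigr => t _; rewrite scalerA.
Qed.

Definition bexpo d : Type := {ffun 'I_n -> 'I_d.+1}.
HB.instance Definition _ d := Finite.on (bexpo d).
Definition bval d (m : bexpo d * bexpo d * bexpo d) : expo * expo * expo :=
  ([ffun i => m.1.1 i : nat], [ffun i => m.1.2 i : nat],
   [ffun i => m.2 i : nat]).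

(* Since [d] bounds each exponent, the degree-d part is finite-dimensional. *)
Lemma heis_deg_fin d : exists N (e : 'I_N.+1 -> H),
  (forall j, heis_deg d (e j)) /\
  (forall u, heis_deg d u -> exists v : 'rV[K]_N.+1, u = \sum_j v 0 j *: e j).
Proof.
pose T := (bexpo d * bexpo d * bexpo d)%type.
pose N := #|{: T}|.
pose e (j : 'I_N.+1) : H :=
  if unlift ord_max j is Some k then
    let m := bval (enum_val (k : 'I_#|{: T}|)) in
    if pbw_deg m == d then pbw m else 0
  else 0.
exists N, e; split=> [j|u].
  rewrite /e; case: unliftP => [k _|_]; last exact: heis_deg0.
  set m := bval _; case: ifP => md; last exact: heis_deg0.
  exists [:: (1, m)]; first by rewrite /= md.
  by rewrite big_seq1 scale1r.
case=> s; elim: s u => [|[c m] s IH] u.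
  move=> _ ->; exists 0; rewrite big_nil big1 // => j _.
  by rewrite mxE scale0r.
move=> /= /andP[md sd] ->; have [v ve] := IH _ sd erefl.
rewrite big_cons ve /=.
have le3 i : (m.1.1 i < d.+1)%N * (m.1.2 i < d.+1)%N * (m.2 i < d.+1)%N.
  have: (m.1.1 i + m.1.2 i + m.2 i <= d)%N.
    by rewrite -(eqP md) /pbw_deg (bigD1 i) //= leq_addr.
  move=> le; rewrite !ltnS; split; [split|]; apply: leq_trans le.
  - by rewrite -addnA leq_addr.
  - by rewrite addnAC leq_addl.
  - by rewrite leq_addl.
pose m' : T := ([ffun i => inord (m.1.1 i)], [ffun i => inord (m.1.2 i)],
                [ffun i => inord (m.2 i)]).
have m'E : bval m' = m.
  rewrite [RHS](surjective_pairing m) (surjective_pairing m.1).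
  by congr (_, _, _); apply/ffunP => i; rewrite !ffunE inordK ?le3.
pose k : 'I_N.+1 := lift ord_max (enum_rank m').
have ek : e k = pbw m by rewrite /e /k liftK enum_rankK m'E md.
exists (c *: delta_mx 0 k + v).
rewrite [RHS](eq_bigr (fun j => (c *: delta_mx 0 k : 'rV[K]_N.+1) 0 j *: e j
                           + v 0 j *: e j)); last first.
  by move=> j _; rewrite !mxE scalerDl.
rewrite big_split /=; congr (_ + _).
rewrite (bigD1 k) //= big1 => [|j jk]; last first.
  by rewrite !mxE (negPf jk) andbF mulr0 scale0r.
by rewrite !mxE !eqxx mulr1 addr0 ek.
Qed.

Section Inverse.
Variables (f : H -> H) (d : nat).
Hypotheses (lf : linear f) (injf : injective f).
Hypothesis fd : forall u, heis_deg d u -> heis_deg d (f u).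

Let f0 : f 0 = 0.
Proof. by have := lf (-1) 0 0; rewrite scaler0 addr0 scaleN1r addNr. Qed.

Let fD u v : f (u + v) = f u + f v.
Proof. by have := lf 1 u v; rewrite !scale1r. Qed.

Let fZ c u : f (c *: u) = c *: f u.
Proof. by have := lf c u 0; rewrite !addr0 f0 addr0. Qed.

Let ev (u : H) (s : seq K) : H := foldr (fun c w => c *: u + f w) 0 s.

Let ev_deg u s : heis_deg d u -> heis_deg d (ev u s).
Proof.
move=> ud; elim: s => [|c s IH] /=; first exact: heis_deg0.
by apply: heis_degD; [apply: heis_degZ | apply: fd].
Qed.

Let ev_inv u s : heis_deg d u -> has (fun c => c != 0) s -> ev u s = 0 ->
  exists2 w, heis_deg d w & u = f w.
Proof.
move=> ud; elim: s => [//|c s IH] /=; have [-> /= hs|cn0 _] := eqVneq c 0.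
  by rewrite scale0r add0r -f0 => /injf; apply: IH.
move=> /eqP; rewrite addr_eq0 => /eqP cu.
exists (- c^-1 *: ev u s); first by apply: heis_degZ; apply: ev_deg.
by rewrite fZ scaleNr -scalerN -cu scalerA mulVf // scale1r.
Qed.

(* By Cayley-Hamilton, an injective endomorphism of a finite-dimensional
   space is onto; hence the inverse of a graded automorphism is graded. *)
Lemma heis_deg_preim u : heis_deg d u -> exists2 w, heis_deg d w & u = f w.
Proof.
move=> ud; have [N [e [ed span]]] := heis_deg_fin d.
pose L (v : 'rV[K]_N.+1) : H := \sum_j v 0 j *: e j.
have LD v w : L (v + w) = L v + L w.
  by rewrite /L -big_split; apply: eq_bigr => j _; rewrite mxE scalerDl.
have LZ c v : L (c *: v) = c *: L v.
  by rewrite /L scaler_sumr; apply: eq_bigr => j _; rewrite mxE scalerA.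
have L0 : L 0 = 0 by rewrite /L big1 // => j _; rewrite mxE scale0r.
have fsum (I : finType) (g : I -> H) : f (\sum_i g i) = \sum_i f (g i).
  exact: (big_morph f fD f0).
have Lsum (I : finType) (g : I -> 'rV[K]_N.+1) :
    L (\sum_i g i) = \sum_i L (g i).
  exact: (big_morph L LD L0).
have [r rE] : exists r : 'I_N.+1 -> 'rV[K]_N.+1, forall j, f (e j) = L (r j).
  have ex j : exists v, f (e j) = L v by apply: span; apply: fd.
  by have [r rE] := boolp.choice ex; exists r.
pose M : 'M[K]_N.+1 := \matrix_(i, j) r i 0 j.
have fL v : f (L v) = L (v *m M).
  rewrite mulmx_sum_row Lsum fsum; apply: eq_bigr => j _.
  by rewrite fZ rE LZ; congr (_ *: L _); apply/rowP => k; rewrite !mxE.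
have [v] := span u ud; rewrite -/(L v) => uE.
have evE s : ev u s = L (v *m horner_mx M (Poly s)).
  elim: s => [|c s IH] /=; first by rewrite rmorph0 mulmx0 L0.
  rewrite IH cons_poly_def rmorphD rmorphM /= horner_mx_X horner_mx_C.
  by rewrite mulmxDr mulmxA LD -fL addrC mul_mx_scalar LZ -uE.
apply: (@ev_inv u (char_poly M) ud).
  have := monic_neq0 (char_poly_monic M); rewrite -lead_coef_eq0 => nz.
  by apply/hasP; exists (lead_coef (char_poly M)) => //; apply: mem_nth;
    rewrite size_char_poly.
by rewrite evE polyseqK Cayley_Hamilton mulmx0 L0.
Qed.

End Inverse.

Fact graded_aut_one_subproof : is_graded_aut id.
Proof. by split=> //; exists id. Qed.

Fact graded_aut_comp_subproof (f g : graded_aut) : is_graded_aut (f \o g).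
Proof.
have [lf [f1 fM] bf df] := graded_autP f.
have [lg [g1 gM] bg dg] := graded_autP g.
split; last by move=> d u ud /=; apply: df; apply: dg.
- by move=> c u v /=; rewrite lg lf.
- by split=> [|u v] /=; rewrite ?g1 ?f1 ?gM ?fM.
- exact: bij_comp.
Qed.

Definition graded_aut_invfun (f : graded_aut) (u : H) : H :=
  xget 0 [set v | f v = u]%classic.

Lemma graded_aut_invfunK (f : graded_aut) : cancel (graded_aut_invfun f) f.
Proof.
move=> u; rewrite /graded_aut_invfun; case: xgetP => [v _ //|nv].
have [_ _ [g fK gK] _] := graded_autP f.
by case: (nv (g u)); rewrite /= gK.
Qed.

Lemma graded_aut_funK (f : graded_aut) : cancel f (graded_aut_invfun f).
Proof.
move=> u; have [_ _ /bij_inj fI _] := graded_autP f.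
by apply: fI; rewrite graded_aut_invfunK.
Qed.

Fact graded_aut_inv_subproof (f : graded_aut) :
  is_graded_aut (graded_aut_invfun f).
Proof.
have [lf [f1 fM] /bij_inj fI df] := graded_autP f.
have fK := graded_aut_invfunK f; have Kf := graded_aut_funK f.
split.
- by move=> c u v; apply: fI; rewrite lf !fK.
- by split=> [|u v]; apply: fI; rewrite ?fM !fK ?f1.
- by exists f.
- move=> d u ud; have [w wd ->] := heis_deg_preim lf fI (df d) ud.
  by rewrite Kf.
Qed.

Definition graded_aut_one : graded_aut :=
  GradedAut (asboolT graded_aut_one_subproof).
Definition graded_aut_mul (f g : graded_aut) : graded_aut :=
  GradedAut (asboolT (graded_aut_comp_subproof f g)).
Definition graded_aut_inv (f : graded_aut) : graded_aut :=
  GradedAut (asboolT (graded_aut_inv_subproof f)).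

(* The product of the group is composition: [(f * g) u = f (g u)]. *)
Fact graded_aut_mulA : associative graded_aut_mul.
Proof. by move=> f g h; apply: graded_aut_eq. Qed.
Fact graded_aut_mul1 : left_id graded_aut_one graded_aut_mul.
Proof. by move=> f; apply: graded_aut_eq. Qed.
Fact graded_aut_mulr1 : right_id graded_aut_one graded_aut_mul.
Proof. by move=> f; apply: graded_aut_eq. Qed.
Fact graded_aut_mulV :
  left_inverse graded_aut_one graded_aut_inv graded_aut_mul.
Proof. by move=> f; apply: graded_aut_eq; apply: graded_aut_funK. Qed.
Fact graded_aut_mulrV :
  right_inverse graded_aut_one graded_aut_inv graded_aut_mul.
Proof. by move=> f; apply: graded_aut_eq; apply: graded_aut_invfunK. Qed.

HB.instance Definition _ := isGroup.Build graded_aut graded_aut_mulA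
  graded_aut_mul1 graded_aut_mulr1 graded_aut_mulV graded_aut_mulrV.

End Grading.

Section MultiplicativeGroup.
Variable K : fieldType.

Record mulgrp : Type := MulGrp { mulgrp_val :> K; mulgrp_neq0 : mulgrp_val != 0 }.

HB.instance Definition _ := [isSub for mulgrp_val].
HB.instance Definition _ := [Choice of mulgrp by <:].

Definition mulgrp_one : mulgrp := MulGrp (oner_neq0 K).
Fact mulgrp_mul_neq0 (a b : mulgrp) : (a : K) * (b : K) != 0.
Proof. by rewrite mulf_neq0 ?mulgrp_neq0. Qed.
Definition mulgrp_mul (a b : mulgrp) : mulgrp := MulGrp (mulgrp_mul_neq0 a b).
Fact mulgrp_inv_neq0 (a : mulgrp) : (a : K)^-1 != 0.
Proof. by rewrite invr_eq0 mulgrp_neq0. Qed.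
Definition mulgrp_inv (a : mulgrp) : mulgrp := MulGrp (mulgrp_inv_neq0 a).

Fact mulgrp_mulA : associative mulgrp_mul.
Proof. by move=> a b c; apply/val_inj/mulrA. Qed.
Fact mulgrp_mul1 : left_id mulgrp_one mulgrp_mul.
Proof. by move=> a; apply/val_inj/mul1r. Qed.
Fact mulgrp_mulr1 : right_id mulgrp_one mulgrp_mul.
Proof. by move=> a; apply/val_inj/mulr1. Qed.
Fact mulgrp_mulV : left_inverse mulgrp_one mulgrp_inv mulgrp_mul.
Proof. by move=> a; apply/val_inj/mulVf/mulgrp_neq0. Qed.
Fact mulgrp_mulrV : right_inverse mulgrp_one mulgrp_inv mulgrp_mul.
Proof. by move=> a; apply/val_inj/mulfV/mulgrp_neq0. Qed.

HB.instance Definition _ := isGroup.Build mulgrp mulgrp_mulA mulgrp_mul1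
  mulgrp_mulr1 mulgrp_mulV mulgrp_mulrV.

End MultiplicativeGroup.

(* S_n with composition of functions as product: [(s * t) i = s (t i)]. The
   product of ['S_n] is the opposite one. *)
Definition symgrp (n : nat) : Type := 'S_n.
HB.instance Definition _ n := Choice.on (symgrp n).

Section SymmetricGroup.
Variable n : nat.

Definition symgrp_mul (s t : symgrp n) : symgrp n := ((t : 'S_n) * s)%g.
Definition symgrp_inv (s : symgrp n) : symgrp n := ((s : 'S_n)^-1)%g.

Fact symgrp_mulA : associative symgrp_mul.
Proof. by move=> s t u; rewrite /symgrp_mul mulgA. Qed.
Fact symgrp_mul1 : left_id (1%g : 'S_n) symgrp_mul.
Proof. exact: mulg1. Qed.
Fact symgrp_mulr1 : right_id (1%g : 'S_n) symgrp_mul.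
Proof. exact: mul1g. Qed.
Fact symgrp_mulV : left_inverse (1%g : 'S_n) symgrp_inv symgrp_mul.
Proof. exact: mulgV. Qed.
Fact symgrp_mulrV : right_inverse (1%g : 'S_n) symgrp_inv symgrp_mul.
Proof. exact: mulVg. Qed.

HB.instance Definition _ := isGroup.Build (symgrp n) symgrp_mulA
  symgrp_mul1 symgrp_mulr1 symgrp_mulV symgrp_mulrV.

Lemma symgrp1E i : (1%g : symgrp n) i = i.
Proof. exact: perm1. Qed.

Lemma symgrpME (s t : symgrp n) i : (s * t)%g i = s (t i).
Proof. exact: permM. Qed.

Lemma symgrpVK (s : symgrp n) i : (s^-1)%g (s i) = i.
Proof. exact: permK. Qed.

End SymmetricGroup.

Record group_action (S N : groupType) := GroupAction {
  gact :> S -> N -> N;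
  gact1 : forall a, gact 1%g a = a;
  gactM : forall s t a, gact (s * t)%g a = gact s (gact t a);
  gactMr : forall s a b, gact s (a * b)%g = (gact s a * gact s b)%g }.

(* The carrier of the external semidirect product of N by S along [act]. *)
Record semidirect (S N : groupType) (act : group_action S N) : Type :=
  SemiDirect { sd_normal : N; sd_compl : S }.
Arguments SemiDirect {S N act}.

Section SemidirectProduct.
Variables (S N : groupType) (act : group_action S N).
Local Notation semidirect := (semidirect act).

Definition semidirect_pair (u : semidirect) : N * S :=
  (sd_normal u, sd_compl u).
Definition pair_semidirect (p : N * S) : semidirect := SemiDirect p.1 p.2.
Lemma semidirect_pairK : cancel semidirect_pair pair_semidirect.
Proof. by case. Qed.

HB.instance Definition _ :=
  Choice.copy semidirect (can_type semidirect_pairK).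

Definition sd_one : semidirect := SemiDirect 1%g 1%g.
Definition sd_mul (u v : semidirect) : semidirect :=
  SemiDirect (sd_normal u * act (sd_compl u) (sd_normal v))%g
             (sd_compl u * sd_compl v)%g.
Definition sd_inv (u : semidirect) : semidirect :=
  SemiDirect (act (sd_compl u)^-1 (sd_normal u)^-1)%g (sd_compl u)^-1%g.

Lemma gact_1 s : act s 1%g = 1%g.
Proof. by apply: (@mulgI _ (act s 1%g)); rewrite -gactMr !mulg1. Qed.

Fact sd_mulA : associative sd_mul.
Proof.
by move=> [a s] [b t] [c u]; rewrite /sd_mul /= gactMr gactM !mulgA.
Qed.
Fact sd_mul1 : left_id sd_one sd_mul.
Proof. by move=> [a s]; rewrite /sd_mul /= gact1 !mul1g. Qed.
Fact sd_mulr1 : right_id sd_one sd_mul.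
Proof. by move=> [a s]; rewrite /sd_mul /= gact_1 !mulg1. Qed.
Fact sd_mulV : left_inverse sd_one sd_inv sd_mul.
Proof. by move=> [a s]; rewrite /sd_mul /= -gactMr !mulVg gact_1. Qed.
Fact sd_mulrV : right_inverse sd_one sd_inv sd_mul.
Proof. by move=> [a s]; rewrite /sd_mul /= -gactM !mulgV gact1 mulgV. Qed.

HB.instance Definition _ := isGroup.Build semidirect sd_mulA sd_mul1
  sd_mulr1 sd_mulV sd_mulrV.

End SemidirectProduct.

Section TorusSym.
Variables (K : fieldType) (n : nat).

(* (K^* )^n x (K^* )^n, with elements (A, B) and componentwise product. *)
Definition torus : groupType :=
  ({ffun 'I_n -> mulgrp K} * {ffun 'I_n -> mulgrp K})%type.

(* The left action of S_n sends the i-th coordinate to the (s i)-th. *)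
Definition permute_ffun (s : symgrp n) (A : {ffun 'I_n -> mulgrp K}) :
  {ffun 'I_n -> mulgrp K} := [ffun i => A ((s^-1)%g i)].

Definition permute_torus (s : symgrp n) (t : torus) : torus :=
  (permute_ffun s t.1, permute_ffun s t.2).

Fact permute_torus1 t : permute_torus 1%g t = t.
Proof.
case: t => A B; rewrite /permute_torus /=; congr (_, _).
all: by apply/ffunP => i; rewrite ffunE invg1 symgrp1E.
Qed.

Fact permute_torusM s t u :
  permute_torus (s * t)%g u = permute_torus s (permute_torus t u).
Proof.
case: u => A B; rewrite /permute_torus /=; congr (_, _).
all: by apply/ffunP => i; rewrite !ffunE invgM symgrpME.
Qed.

Fact permute_torusMr s t u :
  permute_torus s (t * u)%g = (permute_torus s t * permute_torus s u)%g.
Proof.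
case: t u => [A B] [A' B']; rewrite /permute_torus /=.
by congr (_, _); apply/ffunP => i; rewrite !ffunE.
Qed.

Definition torus_action : group_action (symgrp n) torus :=
  GroupAction permute_torus1 permute_torusM permute_torusMr.

Definition torus_sym : groupType := semidirect torus_action.

End TorusSym.

(* Main.v *)
Require Import Defs.
From HB Require Import structures.
From mathcomp Require Import all_boot all_order all_algebra all_fingroup.
From mathcomp Require Import boolp functions reals complex.
From mathcomp Require Import finmap monalg generic_quotient ring zify.

(** A graded automorphism maps the span of the generators to itself, so the
    images X, Y, Z of x_i, y_i, z_i are linear forms with XZ = q ZX,
    YZ = q^-1 ZY and XY = q^-1 YX + Z. Write u -> v when the generators satisfy
    uv = q vu up to linear terms. Comparing the coefficients of the quadratic
    PBW monomials, every generator occurring in X has an arrow to every one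
    occurring in Z, and likewise from Z to Y and from Y to X. As q^2 <> 1, the
    only arrows are the 3-cycles x_j -> z_j -> y_j -> x_j, so X, Y, Z are
    multiples of x_j, y_j, z_j up to rotation. A nontrivial rotation would give
    x_j y_j = q^-1 y_j x_j, which is false because z_j <> 0. PBW coefficients
    are read off the left regular representation, written on functions on the
    lattice of exponents. *)

Set Implicit Arguments.
Unset Strict Implicit.
Unset Printing Implicit Defensive.

Import Order.TTheory GRing.Theory Num.Theory.
Local Open Scope ring_scope.

(** * Modules over the free algebra *)

Section FreeModule.
Variables (K : fieldType) (n : nat).
Local Notation F := (free_alg K n).
Local Notation G := (heis_gen n).

Definition free_gen (s : G) : F := << fmu s >>.

Lemma free_wordE (c : K) (w : {fmonom G}) :
  << c *g w >> = c *: \prod_(s <- (w : seq G)) free_gen s :> F.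
Proof.
have -> : << c *g w >> = c *: << w >> :> F.
  by apply/malgP => k; rewrite mcoeffZ !mcoeffU mulrnAr mulr1.
congr (_ *: _); case: w => w.
elim: w => [|s w IH] /=.
  by rewrite big_nil; congr << _ >>; apply: val_inj; rewrite /= fm1.
rewrite big_cons -{}IH [RHS]malgM_def fgmulUU mulr1.
by congr << _ >>; apply: val_inj; rewrite /= fmM fmU.
Qed.

(** Words grow by one letter on the left, which matches the way [foldr] builds the action below. *)
Lemma free_ind (P : F -> Prop) :
  P 0 -> (forall u v, P u -> P v -> P (u + v)) ->
  (forall c u, P u -> P (c *: u)) -> P 1 ->
  (forall s u, P u -> P (free_gen s * u)) -> forall u, P u.
Proof.
move=> P0 PD PZ P1 PM u; rewrite [u]monalgE.
apply: (big_rec P) => // w v _ Pv; apply: PD Pv.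
rewrite free_wordE; apply: PZ; elim: (w : seq G) => [|s {}w IH].
  by rewrite big_nil.
by rewrite big_cons; apply: PM.
Qed.

Variables (M : lmodType K) (op : G -> M -> M).
Hypothesis op_lin : forall s, linear (op s).

(** The left module structure on [M] determined by the linear operators [op s]: a word acts as the
    composite of its letters, rightmost first. *)
Definition free_act (u : F) (f : M) : M :=
  \sum_(w <- msupp u) u@_w *: foldr op f (w : seq G).

(** Enlarging the support gives a common index set, over which the sums for [u], [v] and
    [c *: u + v] can be compared. *)
Lemma free_actEw (d : {fset {fmonom G}}) u f : (msupp u `<=` d)%fset ->
  free_act u f = \sum_(w <- d) u@_w *: foldr op f (w : seq G).
Proof.
move=> le; rewrite [LHS](big_fset_incl _ le) => //= x xd /mcoeff_outdom ->.
by rewrite scale0r.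
Qed.

Lemma free_actU c (w : {fmonom G}) f :
  free_act << c *g w >> f = c *: foldr op f (w : seq G).
Proof. by rewrite (free_actEw _ msuppU_le) big_seq_fset1 mcoeffUU. Qed.

(** The arguments are swapped so that linearity in the algebra element can be declared as a
    structure. *)
Definition free_actr f u := free_act u f.

Lemma free_actr_is_linear f : linear (free_actr f).
Proof.
rewrite /free_actr.
move=> c u v /=; pose d := (msupp u `|` msupp v)%fset.
have du : (msupp u `<=` d)%fset by apply: fsubsetUl.
have dv : (msupp v `<=` d)%fset by apply: fsubsetUr.
have duv : (msupp (c *: u + v) `<=` d)%fset.
  apply: (fsubset_trans (msuppD_le _ _)); apply: fsetSU; exact: msuppZ_le.
rewrite (free_actEw _ duv) (free_actEw _ du) (free_actEw _ dv).
rewrite scaler_sumr -big_split /=; apply: eq_bigr => w _.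
by rewrite mcoeffD mcoeffZ scalerDl scalerA.
Qed.

HB.instance Definition _ f := GRing.isLinear.Build K F M *:%R (free_actr f)
  (free_actr_is_linear f).

Lemma free_act0 f : free_act 0 f = 0.
Proof. exact: (raddf0 (free_actr f)). Qed.
Lemma free_actD u v f : free_act (u + v) f = free_act u f + free_act v f.
Proof. exact: (raddfD (free_actr f)). Qed.
Lemma free_actZ c u f : free_act (c *: u) f = c *: free_act u f.
Proof. by rewrite -[LHS]/(free_actr f _) linearZ. Qed.

Lemma free_act1 f : free_act 1 f = f.
Proof.
have -> : 1 = << 1 *g @mone {fmonom G} >> :> F by [].
by rewrite free_actU scale1r fm1.
Qed.

Lemma free_act_genM s u f : free_act (free_gen s * u) f = op s (free_act u f).
Proof.
pose L : {linear M -> M} := HB.pack (op s)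
  (GRing.isLinear.Build K M M *:%R (op s) (op_lin s)).
rewrite -[op s]/(L : M -> M) {2}/free_act linear_sum /=.
rewrite [_ * _]malgM_def fgmulUg -/(free_actr f _) raddf_sum.
apply: eq_bigr => w _; rewrite [LHS]free_actU.
by rewrite mul1r fmM fmU -[op s]/(L : M -> M) linearZ.
Qed.

Lemma free_act_gen s f : free_act (free_gen s) f = op s f.
Proof. by rewrite -[free_gen s]mulr1 free_act_genM free_act1. Qed.

Lemma free_actM u v f : free_act (u * v) f = free_act u (free_act v f).
Proof.
elim/free_ind: u => [|u u' IH IH'|c u IH||s u IH].
- by rewrite mul0r !free_act0.
- rewrite (mulrDl u u' v) (free_actD (u * v)) [X in X + _]IH [X in _ + X]IH'.
  exact/esym/free_actD.
- have E : (c *: u) * v = c *: (u * v) by exact/esym/scalerAl.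
  by rewrite E; apply: etrans (free_actZ _ _ _) _; rewrite [X in _ *: X]IH;
    apply/esym/free_actZ.
- by rewrite mul1r free_act1.
- have E : (free_gen s * u) * v = free_gen s * (u * v) by exact/esym/mulrA.
  by rewrite E; apply: etrans (free_act_genM _ _ _) _; rewrite [X in op s X]IH;
    apply/esym/free_act_genM.
Qed.

Lemma free_act_lin u : linear (free_act u).
Proof.
move=> c f g; elim/free_ind: u => [|u u' IH IH'|a u IH||s u IH].
- by rewrite !free_act0 /= scaler0 addr0.
- by rewrite !free_actD IH IH' scalerDr addrACA.
- by rewrite !free_actZ IH scalerDr !scalerA mulrC.
- by rewrite !free_act1.
- by rewrite !free_act_genM IH op_lin.
Qed.

End FreeModule.

(** * Induction on the q-Heisenberg algebra and its modules *)

Definition heis_gens (K : fieldType) (n : nat) (q : K) (s : heis_gen n) :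
    heis n q :=
  match s with
  | inl (inl i) => heis_x q i | inl (inr i) => heis_y q i | inr i => heis_z q i
  end.

Lemma heis_gensE (K : fieldType) (n : nat) (q : K) (s : heis_gen n) :
  heis_gens q s = heis_pi q (free_gen K s).
Proof.
by case: s => [[i|i]|i] /=;
  rewrite ?heis_x.unlock ?heis_y.unlock ?heis_z.unlock.
Qed.

Section HeisInd.
Variables (K : fieldType) (n : nat) (q : K).
Local Notation H := (heis n q).

Lemma heis_ind (P : H -> Prop) :
  P 0 -> (forall u v, P u -> P v -> P (u + v)) ->
  (forall c u, P u -> P (c *: u)) -> P 1 ->
  (forall s u, P u -> P (heis_gens q s * u)) -> forall u, P u.
Proof.
move=> P0 PD PZ P1 PM u; have [v ->] := heis_pi_surj u.
elim/free_ind: v => [|v w Pv Pw|c v Pv||s v Pv].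
- by rewrite (_ : heis_pi q 0 = 0) // heis_piE raddf0.
- by rewrite heis_piD; apply: PD.
- by rewrite heis_piZ; apply: PZ.
- exact: P1.
- by rewrite heis_piM -heis_gensE; apply: PM.
Qed.

Variables (M : lmodType K) (op : heis_gen n -> M -> M).
Hypothesis op_lin : forall s, linear (op s).
Hypothesis op_rel :
  forall u v, free_rel q u v -> forall f, free_act op u f = free_act op v f.

Definition heis_act (h : H) (f : M) : M := free_act op (repr h) f.

(** Since the operators satisfy the relations, the two-sided ideal acts by zero, so the choice of
    [repr] does not matter. *)
Lemma heis_act_pi u f : heis_act (heis_pi q u) f = free_act op u f.
Proof.
suff ideal_act v : heis_ideal q v -> forall f', free_act op v f' = 0.
  by have := ideal_act _ (repr_pi q u) f; rewrite -scaleN1r free_actD free_actZ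
    scaleN1r => /eqP; rewrite subr_eq0 => /eqP.
elim=> {v} [v w /op_rel r|//|v w _ IH _ IH'|a v _ IH|a v _ IH] f'.
- by rewrite -scaleN1r free_actD free_actZ scaleN1r r subrr.
- exact: free_act0.
- by rewrite free_actD IH IH' addr0.
- rewrite free_actM // IH.
  by have := free_act_lin op_lin a (-1) 0 0;
    rewrite scaler0 addr0 scaleN1r addNr.
- by rewrite free_actM // IH.
Qed.

Lemma heis_act_is_linear f : linear (heis_act^~ f).
Proof.
move=> c u v; case: (heis_pi_surj u) (heis_pi_surj v) => {}u -> [{}v ->] /=.
have -> : c *: heis_pi q u + heis_pi q v = heis_pi q (c *: u + v).
  by rewrite heis_piD heis_piZ.
by rewrite !heis_act_pi free_actD free_actZ.
Qed.

Lemma heis_act1 f : heis_act 1 f = f.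
Proof. by rewrite heis_act_pi free_act1. Qed.

Lemma heis_actM g h f : heis_act (g * h) f = heis_act g (heis_act h f).
Proof.
case: (heis_pi_surj g) (heis_pi_surj h) => {}g -> [{}h ->].
by rewrite -[_ * _]heis_piM !heis_act_pi free_actM.
Qed.

Lemma heis_act_gens s f : heis_act (heis_gens q s) f = op s f.
Proof. by rewrite heis_gensE heis_act_pi free_act_gen. Qed.

End HeisInd.

(** * Defining relations and the universal property *)

Definition gen_index (n : nat) (s : heis_gen n) : 'I_n :=
  match s with inl (inl i) | inl (inr i) | inr i => i end.
Definition gen_x (n : nat) (i : 'I_n) : heis_gen n := inl (inl i).
Definition gen_y (n : nat) (i : 'I_n) : heis_gen n := inl (inr i).
Definition gen_z (n : nat) (i : 'I_n) : heis_gen n := inr i.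

Lemma gen_ind (n : nat) (P : heis_gen n -> Prop) :
  (forall i, P (gen_x i)) -> (forall i, P (gen_y i)) ->
  (forall i, P (gen_z i)) -> forall s, P s.
Proof. by move=> Px Py Pz [[i|i]|i]; [apply: Px | apply: Py | apply: Pz]. Qed.

(** Reduces the nine families of relations to four checks: the six commutation families all follow
    from the single hypothesis on distinct indices. *)
Lemma op_heis_rel (K : fieldType) (n : nat) (q : K) (M : lmodType K)
    (op : heis_gen n -> M -> M) (op_lin : forall s, linear (op s)) :
  (forall s t f, gen_index s != gen_index t ->
     op s (op t f) = op t (op s f)) ->
  (forall i f, op (gen_x i) (op (gen_z i) f) =
     q *: op (gen_z i) (op (gen_x i) f)) ->
  (forall i f, op (gen_y i) (op (gen_z i) f) =
     q^-1 *: op (gen_z i) (op (gen_y i) f)) ->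
  (forall i f, op (gen_x i) (op (gen_y i) f) =
     q^-1 *: op (gen_y i) (op (gen_x i) f) + op (gen_z i) f) ->
  forall u v, free_rel q u v -> forall f, free_act op u f = free_act op v f.
Proof.
move=> opC opxz opyz opxy u v r f.
have act2 s t :
    free_act op (free_gen K s * free_gen K t) f = op s (op t f).
  by rewrite free_act_genM // free_act_gen.
have actZ2 c s t : free_act op (c *: (free_gen K s * free_gen K t)) f =
    c *: op s (op t f).
  exact: etrans (free_actZ _ _ _ _) (congr1 _ (act2 s t)).
have comm s t : gen_index s != gen_index t ->
    free_act op (free_gen K s * free_gen K t) f =
    free_act op (free_gen K t * free_gen K s) f.
  move=> st.
  exact: etrans (act2 s t) (etrans (opC _ _ f st) (esym (act2 t s))).
have ltneq (i j : 'I_n) : (i < j)%N -> i != j by move=> ij; rewrite neq_ltn ij.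
case: r => [i j /ltneq ij|i j /ltneq ij|i j /ltneq ij|i|i|i|i j ij|i j ij
  |i j ij].
- exact: (comm (gen_x i) (gen_x j)).
- exact: (comm (gen_y i) (gen_y j)).
- exact: (comm (gen_z i) (gen_z j)).
- apply: etrans (act2 (gen_x i) (gen_z i)) (etrans (opxz i f) (esym _)).
  exact: (actZ2 q (gen_z i) (gen_x i)).
- apply: etrans (act2 (gen_y i) (gen_z i)) (etrans (opyz i f) (esym _)).
  exact: (actZ2 q^-1 (gen_z i) (gen_y i)).
- apply: etrans (act2 (gen_x i) (gen_y i)) (etrans (opxy i f) (esym _)).
  apply: etrans (free_actD _ _ _ _) (congr2 _ _ _).
    exact: (actZ2 q^-1 (gen_y i) (gen_x i)).
  exact: (free_act_gen op_lin (gen_z i) f).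
- exact: (comm (gen_x i) (gen_y j)).
- exact: (comm (gen_x i) (gen_z j)).
- exact: (comm (gen_y i) (gen_z j)).
Qed.

Section HeisRelations.
Variables (K : fieldType) (n : nat) (q : K).
Local Notation g := (heis_gens q).

Lemma heis_gensC s t : gen_index s != gen_index t ->
  g s * g t = g t * g s :> heis n q.
Proof.
have cmp (i j : 'I_n) : i != j -> (i < j)%N \/ (j < i)%N.
  by rewrite neq_ltn => /orP.
elim/gen_ind: s => i; elim/gen_ind: t => j /= ij.
- by case: (cmp _ _ ij) => lt; [|symmetry]; apply: heis_relP; constructor.
- by apply: heis_relP; constructor.
- by apply: heis_relP; constructor.
- by symmetry; apply: heis_relP; constructor; rewrite eq_sym.
- by case: (cmp _ _ ij) => lt; [|symmetry]; apply: heis_relP; constructor.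
- by apply: heis_relP; constructor.
- by symmetry; apply: heis_relP; constructor; rewrite eq_sym.
- by symmetry; apply: heis_relP; constructor; rewrite eq_sym.
- by case: (cmp _ _ ij) => lt; [|symmetry]; apply: heis_relP; constructor.
Qed.

Lemma heis_xz (i : 'I_n) :
  heis_x q i * heis_z q i = q *: (heis_z q i * heis_x q i).
Proof. by apply: heis_relP; constructor. Qed.

Lemma heis_yz (i : 'I_n) :
  heis_y q i * heis_z q i = q^-1 *: (heis_z q i * heis_y q i).
Proof. by apply: heis_relP; constructor. Qed.

Lemma heis_xy (i : 'I_n) :
  heis_x q i * heis_y q i = q^-1 *: (heis_y q i * heis_x q i) + heis_z q i.
Proof. by apply: heis_relP; constructor. Qed.

Lemma heis_morph_ext (A : lalgType K) (f g : heis n q -> A) :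
  linear f -> monoid_morphism f -> linear g -> monoid_morphism g ->
  (forall s, f (heis_gens q s) = g (heis_gens q s)) -> f =1 g.
Proof.
move=> lf [f1 fM] lg [g1 gM] fg u.
have lin0 (h : heis n q -> A) : linear h -> h 0 = 0.
  by move=> lh; have := lh (-1) 0 0; rewrite scaler0 addr0 scaleN1r addNr.
elim/heis_ind: u => [|u v Pu Pv|c u Pu||s u Pu].
- by rewrite !lin0.
- have := lf 1 u v; have := lg 1 u v; rewrite !scale1r => -> ->.
  by rewrite Pu Pv.
- have := lf c u 0; have := lg c u 0.
  by rewrite !addr0 !lin0 // !addr0 => -> ->; rewrite Pu.
- by rewrite f1 g1.
- by rewrite fM gM fg Pu.
Qed.

Section Lift.
Variables (A : algType K) (G : heis_gen n -> A).
Hypothesis GC : forall s t, gen_index s != gen_index t -> G s * G t = G t * G s.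
Hypothesis Gxz :
  forall i, G (gen_x i) * G (gen_z i) = q *: (G (gen_z i) * G (gen_x i)).
Hypothesis Gyz :
  forall i, G (gen_y i) * G (gen_z i) = q^-1 *: (G (gen_z i) * G (gen_y i)).
Hypothesis Gxy : forall i, G (gen_x i) * G (gen_y i) =
  q^-1 *: (G (gen_y i) * G (gen_x i)) + G (gen_z i).

(** Left multiplication by the elements [G s] turns [A] into a module over [heis n q], and the
    morphism sends [h] to the result of its action on 1. *)
Lemma heis_lift : exists f : heis n q -> A,
  [/\ linear f, monoid_morphism f & forall s, f (heis_gens q s) = G s].
Proof.
pose op s (a : A) := G s * a.
have op_lin s : linear (op s).
  by move=> c u v; rewrite /op mulrDr scalerAr.
have op_rel : forall u v, free_rel q u v ->
    forall f, free_act op u f = free_act op v f.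
  apply: op_heis_rel => //; rewrite /op.
  - by move=> s t f st; rewrite !mulrA GC.
  - by move=> i f; rewrite !mulrA Gxz -scalerAl.
  - by move=> i f; rewrite !mulrA Gyz -scalerAl.
  - by move=> i f; rewrite !mulrA Gxy mulrDl -scalerAl.
(* The action of [h] is left multiplication by its value at 1; this turns compatibility of the
   action with products into multiplicativity of the morphism. *)
have actE (h : heis n q) a : heis_act op h a = heis_act op h 1 * a.
  elim/heis_ind: h => [|u v Pu Pv|c u Pu||s u Pu].
  - have act0 b : heis_act op (0 : heis n q) b = 0.
      have := heis_act_is_linear op_lin op_rel b (-1) 0 0.
      by rewrite /= scaler0 addr0 scaleN1r addNr.
    by rewrite !act0 mul0r.
  - have actD b : heis_act op (u + v) b = heis_act op u b + heis_act op v b.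
      by have := heis_act_is_linear op_lin op_rel b 1 u v; rewrite !scale1r.
    by rewrite !actD Pu Pv mulrDl.
  (* [c *: u] is written as [(c - 1) *: u + u], so that linearity of the action applies with both
     arguments equal to [u]. *)
  - have actZ b : heis_act op (c *: u) b = c *: heis_act op u b.
      have := heis_act_is_linear op_lin op_rel b (c - 1) u u.
      rewrite -[X in _ *: _ + X]scale1r -scalerDl subrK /=.
      by rewrite -[X in _ + X]scale1r -scalerDl subrK.
    by rewrite !actZ Pu scalerAl.
  - by rewrite !heis_act1 // mul1r.
  - rewrite !(heis_actM op_lin op_rel) !(heis_act_gens op_lin op_rel).
    by rewrite /op Pu mulrA.
exists (fun h => heis_act op h 1); split.
- exact: heis_act_is_linear.
- split=> [|u v]; first exact: heis_act1.
  by rewrite (heis_actM op_lin op_rel) actE.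
- by move=> s; rewrite (heis_act_gens op_lin op_rel) /op mulr1.
Qed.

End Lift.
End HeisRelations.

(** * Left regular representation and quadratic PBW coefficients *)

HB.instance Definition _ n := Finite.on (heis_gen n).

(* [nxt s] is the target of the only arrow out of [s]. *)
Definition nxt (n : nat) (s : heis_gen n) : heis_gen n :=
  match s with
  | inl (inl i) => gen_z i | inl (inr i) => gen_x i | inr i => gen_y i
  end.

Section RegularRepresentation.
Variables (K : fieldType) (n : nat) (q : K).
Hypotheses (q0 : q != 0) (q2 : q ^+ 2 != 1).
Local Notation G := (heis_gen n).
Local Notation P := {ffun G -> int}.
Local Notation M := (P -> K^o).

Definition unit_expo (s : G) : P := [ffun t => (t == s)%:R].
Local Notation e := unit_expo.

(* x y^b = q^-b y^b x + [b] z y^(b-1) *)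
Definition qint (b : int) : K := (1 - q ^ (- 2 * b)) / (1 - q ^ (- 2)).

Lemma qint0 : qint 0 = 0.
Proof. by rewrite /qint mulr0 expr0z subrr mul0r. Qed.

Lemma qintS b : qint (b + 1) = q ^ (- 2) * qint b + 1.
Proof.
have q2' : 1 - q ^ (- 2) != 0.
  by rewrite subr_eq0 eq_sym -exprnN invr_eq1.
rewrite /qint mulrDr mulr1 expfzDr //.
move: (q ^ (- 2 * b)) (q ^ (- 2)) q2' => B A A1.
by field.
Qed.

(* On PBW monomials, x z^a y^b x^c = q^(a-b) z^a y^b x^(c+1)
   + q^a [b] z^(a+1) y^(b-1) x^c and y z^a y^b x^c = q^-a z^a y^(b+1) x^c.
   [reg_op] is the induced map on coefficient functions; exponents range over
   Z, and [0] = 0 makes a boundary case at b = 0 unnecessary. *)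
Definition coef1 (s : G) (m : P) : K :=
  match s with
  | inl (inl i) => q ^ (m (gen_z i) - m (gen_y i))
  | inl (inr i) => q ^ (- m (gen_z i))
  | inr i => 1
  end.

(** The term landing on [m] comes from the exponent [m + shift2 s], where a is one lower and b one
    higher; hence the -1 and the +1. *)
Definition coef2 (s : G) (m : P) : K :=
  if s is inl (inl i) then q ^ (m (gen_z i) - 1) * qint (m (gen_y i) + 1)
  else 0.

Definition shift2 (s : G) : P :=
  e (gen_y (gen_index s)) - e (gen_z (gen_index s)).

Definition reg_op (s : G) (f : M) : M := fun m =>
  coef1 s m * f (m - e s) + coef2 s m * f (m + shift2 s).

Lemma reg_op_lin s : linear (reg_op s).
Proof.
move=> c f g; apply/funext => m; rewrite /reg_op.
rewrite -[(c *: f + g) (m - _)]/(c * f (m - e s) + g (m - e s)).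
rewrite -[(c *: f + g) (m + _)]/(c * f (m + shift2 s) + g (m + shift2 s)).
rewrite -[RHS]/(c * (reg_op s f m) + (reg_op s g m)) /reg_op.
ring.
Qed.

(** Operators of different index read and shift disjoint sets of coordinates, so the coefficients of
    one are unchanged by the shifts of the other ([coefD]). *)
Lemma reg_opC s t f : gen_index s != gen_index t ->
  reg_op s (reg_op t f) = reg_op t (reg_op s f).
Proof.
have coefD s' t' m (p : P) : gen_index s' != gen_index t' ->
    (p = - e t') \/ (p = shift2 t') ->
    coef1 s' (m + p) = coef1 s' m /\ coef2 s' (m + p) = coef2 s' m.
  move=> st pE.
  have p0 u : gen_index u = gen_index s' -> p u = 0.
    move=> us; have ut v : gen_index v = gen_index t' -> (u == v) = false.
      by move=> vt; apply/negP => /eqP uv; rewrite -us -vt uv eqxx in st.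
    case: pE => ->; rewrite !ffunE ut //; last by rewrite !ut.
  split; rewrite /coef1 /coef2; elim/gen_ind: s' st p0 => i st p0 //=;
    rewrite !ffunE !p0 ?addr0 //.
move=> st; apply/funext => m; rewrite /reg_op.
have ts : gen_index t != gen_index s by rewrite eq_sym.
have [-> ->] := coefD t s m _ ts (or_introl erefl).
have [-> ->] := coefD t s m _ ts (or_intror erefl).
have [-> ->] := coefD s t m _ st (or_introl erefl).
have [-> ->] := coefD s t m _ st (or_intror erefl).
rewrite (addrAC m (- e t) (- e s)) (addrAC m (- e t) (shift2 s)).
rewrite (addrAC m (shift2 t) (- e s)) (addrAC m (shift2 t) (shift2 s)).
ring.
Qed.

Let coordE := (mulr1n, mulr0n, subr0, addr0, sub0r, add0r).

Lemma reg_opxz i f : reg_op (gen_x i) (reg_op (gen_z i) f) =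
  q *: reg_op (gen_z i) (reg_op (gen_x i) f).
Proof.
apply/funext => m; rewrite -[RHS]/(q * reg_op _ _ m) /reg_op /=.
rewrite !ffunE /= !eqxx !coordE !mul0r !addr0 !mul1r.
rewrite (addrAC m _ (- e (gen_z i))) (addrAC m (shift2 _)).
rewrite !expfzDr // exprN1.
move: (f _) (f _) (q ^ _) (q ^ (- _)) (qint _) => F F' A B C.
by field.
Qed.

Lemma reg_opyz i f : reg_op (gen_y i) (reg_op (gen_z i) f) =
  q^-1 *: reg_op (gen_z i) (reg_op (gen_y i) f).
Proof.
apply/funext => m; rewrite -[RHS]/(q^-1 * reg_op _ _ m) /reg_op /=.
rewrite !ffunE /= !eqxx !coordE !mul0r !addr0 !mul1r.
rewrite (addrAC m _ (- e (gen_z i))) opprB expfzDr // expr1z.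
move: (f _) (q ^ _) => F A.
by field.
Qed.

Lemma reg_opxy i f : reg_op (gen_x i) (reg_op (gen_y i) f) =
  q^-1 *: reg_op (gen_y i) (reg_op (gen_x i) f) + reg_op (gen_z i) f.
Proof.
apply/funext => m.
rewrite -[RHS]/(q^-1 * reg_op _ (reg_op _ _) m + reg_op _ _ m) /reg_op /=.
rewrite !ffunE /= !eqxx !coordE !mul0r !addr0 !mul1r.
have -> : m + shift2 (gen_x i) - e (gen_y i) = m - e (gen_z i).
  by rewrite /shift2 /= addrA addrAC addrK.
have -> : m - e (gen_y i) + shift2 (gen_x i) = m - e (gen_z i).
  by rewrite /shift2 /= addrA subrK.
(* With b the y-exponent of [m], the left side carries [b+1] and the right side [b]; the summand 1
   in [qintS] accounts for the operator of z. *)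
rewrite (addrAC m _ (- e (gen_y i))) subrK qintS !opprB.
rewrite !expfzDr // exprN1 expr1z -!invr_expz.
rewrite -[q ^ 2]/(q ^+ 2).
have := expfz_neq0 (m (gen_z i)) q0; have := expfz_neq0 (m (gen_y i)) q0.
move: (f _) (f _) (q ^ _) (q ^ (m _)) (qint _) => F F' A B C A0 B0.
by field; rewrite q0 A0 B0.
Qed.

Definition delta (p : P) : M := fun m => (m == p)%:R.

(** [delta 0] stands for the monomial 1, so letting [h] act on it yields the coefficient function of
    [h]. *)
Definition pbw_coef (m : P) (h : heis n q) : K := heis_act reg_op h (delta 0) m.

Lemma reg_op_rel u v : free_rel q u v ->
  forall f, free_act reg_op u f = free_act reg_op v f.
Proof.
apply: op_heis_rel; [exact: reg_op_lin|exact: reg_opC|exact: reg_opxz|..].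
- exact: reg_opyz.
- exact: reg_opxy.
Qed.

Lemma pbw_coef_is_linear m : scalar (pbw_coef m).
Proof.
move=> c u v; rewrite /pbw_coef.
by have /= -> := heis_act_is_linear reg_op_lin reg_op_rel (delta 0) c u v.
Qed.

HB.instance Definition _ m :=
  GRing.isLinear.Build K (heis n q) K *%R (pbw_coef m) (pbw_coef_is_linear m).

Lemma coef1_self s : coef1 s (e s) = 1.
Proof. by elim/gen_ind: s => i //=; rewrite !ffunE /= ?eqxx. Qed.

Lemma reg_op_delta0 s : reg_op s (delta 0) = delta (e s).
Proof.
apply/funext => m; rewrite /reg_op /delta subr_eq0.
(* The only candidate is [m = - shift2 s], whose y-exponent is -1, and there the factor is [0] =
   0. *)
have -> : coef2 s m * (m + shift2 s == 0)%:R = 0.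
  have [/eqP|_] := eqVneq (m + shift2 s) 0; last by rewrite mulr0.
  rewrite addr_eq0 => /eqP ->; elim/gen_ind: s => i; rewrite /= ?mul0r //.
  by rewrite !ffunE /= !eqxx !coordE addNr qint0 mulr0 mul0r.
rewrite addr0; have [->|_] := eqVneq m (e s); last by rewrite mulr0.
by rewrite coef1_self mulr1.
Qed.

(* st = kappa s t * (PBW monomial on s and t) + linear terms *)
Definition kappa (s t : G) : K := coef1 s (e s + e t).

Lemma total_unit s : \sum_t e s t = 1.
Proof.
rewrite (bigD1 s) //= big1 ?ffunE ?eqxx ?addr0 // => t ts.
by rewrite ffunE (negPf ts).
Qed.

Lemma total_add (m p : P) : \sum_t (m + p) t = \sum_t m t + \sum_t p t.
Proof. by rewrite -big_split; apply: eq_bigr => t _; rewrite ffunE. Qed.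

Lemma pbw_coef_gen2 u v s t :
  pbw_coef (e u + e v) (heis_gens q s * heis_gens q t) =
  kappa s t * (e u + e v == e s + e t)%:R.
Proof.
rewrite /pbw_coef (heis_actM reg_op_lin reg_op_rel).
rewrite !(heis_act_gens reg_op_lin reg_op_rel) reg_op_delta0 /reg_op /delta.
(* [shift2] has total degree 0, so the two sides have total degrees 2 and 1. *)
have -> : (e u + e v + shift2 s == e t) = false.
  apply/negP => /eqP/(congr1 (fun m : P => \sum_t m t)).
  have totN (m : P) : \sum_t (- m) t = - \sum_t m t.
    by rewrite -sumrN; apply: eq_bigr => w _; rewrite ffunE.
  by rewrite !total_add totN !total_unit.
rewrite mulr0 addr0 subr_eq (addrC (e t)).
by have [->|_] := eqVneq (e u + e v) (e s + e t); rewrite ?mulr0.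
Qed.

Lemma pbw_coef_gen1 m s : pbw_coef m (heis_gens q s) = (m == e s)%:R.
Proof.
by rewrite /pbw_coef (heis_act_gens reg_op_lin reg_op_rel) reg_op_delta0.
Qed.

Lemma unit_expo_inj : injective e.
Proof.
move=> s t /ffunP/(_ s); rewrite !ffunE eqxx.
by case: eqVneq.
Qed.

Lemma unit_expo2_eq u v s t :
  (e u + e v == e s + e t) = (s == u) && (t == v) || (s == v) && (t == u).
Proof.
apply/eqP/idP => [E|/orP[]/andP[/eqP-> /eqP->]//]; last exact: addrC.
have : (s == u) || (s == v).
  apply: contraT; rewrite negb_or => /andP[su sv].
  move/ffunP/(_ s): E; rewrite !ffunE (negPf su) (negPf sv) eqxx.
  by case: (s == t).
case/orP => /eqP se; rewrite se in E *; rewrite eqxx /=.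
  by move/addrI/unit_expo_inj: E => ->; rewrite eqxx.
by rewrite addrC in E; move/addrI/unit_expo_inj: E => ->; rewrite eqxx orbT.
Qed.

Definition lin_form (a : G -> K) : heis n q := \sum_s a s *: heis_gens q s.

Lemma pbw_coef_lin_form u v a : pbw_coef (e u + e v) (lin_form a) = 0.
Proof.
rewrite linear_sum big1 // => s _; rewrite linearZ /= pbw_coef_gen1.
case: eqVneq => [/(congr1 (fun m : P => \sum_t m t))|_]; last by rewrite mulr0.
by rewrite total_add !total_unit.
Qed.

(** The monomial on [u] and [v] arises from the ordered pairs (u, v) and (v, u); the factor
    [(u != v)%:R] keeps a square from being counted twice. *)
Lemma pbw_coef_lin_form2 u v a b :
  pbw_coef (e u + e v) (lin_form a * lin_form b) =
  a u * b v * kappa u v + (u != v)%:R * (a v * b u * kappa v u).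
Proof.
rewrite mulr_suml linear_sum.
have -> : \sum_s pbw_coef (e u + e v) (a s *: heis_gens q s * lin_form b) =
   \sum_s \sum_t a s * b t * kappa s t * (e u + e v == e s + e t)%:R.
  apply: eq_bigr => s _; rewrite mulr_sumr linear_sum; apply: eq_bigr => t _.
  by rewrite -scalerAl -scalerAr !linearZ /= pbw_coef_gen2 !mulrA.
have sum1 (s t : G) F :
    \sum_s' \sum_t' F s' t' * ((s' == s) && (t' == t))%:R = F s t :> K.
  rewrite (bigD1 s) //= (bigD1 t) //= !eqxx mulr1 !big1 ?addr0 // => [s'|t'] ne.
    by rewrite big1 // => t' _; rewrite (negPf ne) mulr0.
  by rewrite (negPf ne) mulr0.
rewrite -(sum1 u v (fun s t => a s * b t * kappa s t)).
rewrite -(sum1 v u (fun s t => a s * b t * kappa s t)).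
rewrite mulr_sumr -big_split; apply: eq_bigr => s _.
rewrite mulr_sumr -big_split; apply: eq_bigr => t _ /=.
rewrite unit_expo2_eq; have [uv|/negPf uv] := eqVneq u v.
  by rewrite uv orbb mul0r addr0.
rewrite mul1r -mulrDr -natrD; congr (_ * _%:R).
by have [->|_] := eqVneq s u; rewrite /= ?uv ?orbF ?addn0.
Qed.

Lemma kappa_neq0 s t : kappa s t != 0.
Proof.
by elim/gen_ind: s => i; rewrite /kappa /= ?oner_neq0 // expfz_neq0.
Qed.

(* The coefficients of the squares force disjoint supports. *)
Lemma lin_form_qcomm a b l c u v : c != 1 ->
  lin_form a * lin_form b = c *: (lin_form b * lin_form a) + lin_form l ->
  a u != 0 -> b v != 0 -> kappa u v = c * kappa v u.
Proof.
move=> c1 E au bv.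
have coefE s t : a s * b t * kappa s t + (s != t)%:R * (a t * b s * kappa t s) =
    c * (b s * a t * kappa s t + (s != t)%:R * (b t * a s * kappa t s)).
  rewrite -!pbw_coef_lin_form2 E linearD linearZ /= pbw_coef_lin_form addr0.
  by [].
have ab0 s : a s * b s = 0.
  have := coefE s s; rewrite eqxx !mul0r !addr0 mulrA (mulrC (b s)).
  rewrite -{1}[_ * b s]mul1r.
  move/(mulIf (kappa_neq0 s s))/eqP; rewrite -subr_eq0 -mulrBl mulf_eq0.
  by rewrite subr_eq0 eq_sym (negPf c1) => /eqP.
have bu : b u = 0 by have /eqP := ab0 u; rewrite mulf_eq0 (negPf au) => /eqP.
have av : a v = 0.
  by have /eqP := ab0 v; rewrite mulf_eq0 (negPf bv) orbF => /eqP.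
have uv : u != v by apply: contraNneq au => ->; rewrite av.
(* Disjoint supports leave one product on each side, and the common factor [a u * b v] cancels. *)
have := coefE u v; rewrite bu av uv !(mulr0, mul0r, mul1r) addr0 add0r.
rewrite (mulrC (b v)) mulrCA => /mulfI; apply.
by rewrite mulf_neq0.
Qed.

(** [kappa] only takes the values 1, q and q^-1. As q^2 differs from 1, so does q, and q^-1 differs
    from q, which rules out every coincidence other than the 3-cycles. *)
Lemma kappa_nxt u v : kappa u v = q * kappa v u -> v = nxt u.
Proof.
have q1 : (q == 1) = false.
  by apply: contraNF q2 => /eqP ->; rewrite expr1n.
have qV : (q^-1 == q) = false.
  by apply: contraNF q2 => /eqP E; rewrite expr2 -{1}E mulVf.
(* The exponent of q is plus or minus the indicator of an equality of generators; these are the four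
   shapes that the equation then takes. *)
have key (b : bool) : [/\ (q ^ (- (b%:R : int)) == q) = false,
    (1 == q * q ^ (- (b%:R : int))) = b, (q ^ (b%:R : int) == q) = b &
    (1 == q * q ^ (b%:R : int)) = false].
  case: b; rewrite /= ?mulr1n ?mulr0n ?oppr0 ?expr0z ?expr1z ?exprN1 ?mulr1.
    by rewrite mulfV // !eqxx -expr2 [1 == _]eq_sym (negPf q2).
  by rewrite ![1 == _]eq_sym q1.
move=> /eqP; elim/gen_ind: u => i; elim/gen_ind: v => j;
  rewrite /kappa /= ?ffunE /=.
all: rewrite ?mulr0n ?subr0 ?sub0r ?addr0 ?add0r ?oppr0 ?expr0z ?mulr1.
all: rewrite 1?[1 == q]eq_sym ?q1 //.
- by have [->] := key (gen_y i == gen_y j).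
- by have [_ _ -> _] := key (gen_z i == gen_z j); rewrite eq_sym => /eqP.
- by have [_ -> _ _] := key (gen_y j == gen_y i) => /eqP[->].
- by have [->] := key (gen_z i == gen_z j).
- by have [_ _ _ ->] := key (gen_z j == gen_z i).
- by have [_ -> _ _] := key (gen_z j == gen_z i) => /eqP[->].
Qed.

Lemma lin_form_neq0 a : lin_form a != 0 -> exists s, a s != 0.
Proof.
move=> a0; apply/existsP; apply: contraR a0; rewrite negb_exists => /forallP a0.
rewrite /lin_form big1 // => s _; have := a0 s; rewrite negbK => /eqP ->.
by rewrite scale0r.
Qed.

Lemma lin_form_single a u : (forall s, a s != 0 -> s = u) ->
  lin_form a = a u *: heis_gens q u.
Proof.
move=> au; rewrite /lin_form (bigD1 u) //= big1 ?addr0 // => s su.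
have [->|/au E] := eqVneq (a s) 0; first by rewrite scale0r.
by rewrite E eqxx in su.
Qed.

Lemma heis_gens_neq0 s : heis_gens q s != 0 :> heis n q.
Proof.
apply/eqP => /(congr1 (pbw_coef (e s))); rewrite pbw_coef_gen1 eqxx linear0.
by apply/eqP; rewrite oner_eq0.
Qed.

Lemma heis_gens_scale_inj (a b : K) (s t : G) : a != 0 ->
  a *: heis_gens q s = b *: heis_gens q t -> s = t /\ a = b.
Proof.
move=> a0 /(congr1 (pbw_coef (e s))).
rewrite !linearZ /= !pbw_coef_gen1 eqxx mulr1 (inj_eq unit_expo_inj).
have [->|_ aE] := eqVneq s t; first by rewrite mulr1.
by rewrite aE mulr0 eqxx in a0.
Qed.

Lemma nxt_inj : injective (@nxt n).
Proof. by case=> [[i|i]|i] [[j|j]|j] //= [->]. Qed.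

Lemma heis_linear_triple a b d (X := lin_form a) (Y := lin_form b)
    (Z := lin_form d) :
  X != 0 -> Y != 0 -> Z != 0 ->
  X * Z = q *: (Z * X) -> Y * Z = q^-1 *: (Z * Y) ->
  X * Y = q^-1 *: (Y * X) + Z ->
  exists j : 'I_n, exists A B : K,
    [/\ A != 0, B != 0, X = A *: heis_x q j, Y = B *: heis_y q j &
        Z = (A * B) *: heis_z q j].
Proof.
move=> X0 Y0 Z0 XZ YZ XY.
have q1 : q != 1 by apply: contraNneq q2 => ->; rewrite expr1n.
have qV1 : q^-1 != 1 by rewrite invr_eq1.
have lin_form0 : lin_form (fun=> 0) = 0.
  by rewrite /lin_form big1 // => s _; rewrite scale0r.
have arrXZ u v : a u != 0 -> d v != 0 -> v = nxt u.
  move=> au dv; apply: kappa_nxt.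
  apply: (lin_form_qcomm (l := fun=> 0)) au dv => //.
  by rewrite lin_form0 addr0.
(* The factor q^-1 reverses the arrow: [kappa w v] is q^-1 times [kappa v w]. *)
have arrZY v w : d v != 0 -> b w != 0 -> w = nxt v.
  move=> dv bw; apply: kappa_nxt.
  have := lin_form_qcomm (l := fun=> 0) qV1 _ bw dv.
  by rewrite lin_form0 addr0 => /(_ YZ) ->; rewrite mulVKf.
have arrYX w u : b w != 0 -> a u != 0 -> u = nxt w.
  move=> bw au; apply: kappa_nxt; have -> := lin_form_qcomm qV1 XY au bw.
  by rewrite mulVKf.
have [u au] := lin_form_neq0 X0; have [w bw] := lin_form_neq0 Y0.
have [v dv] := lin_form_neq0 Z0.
(* Every generator occurring in [X] has the same target [v], so injectivity of [nxt] leaves only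
   one; the same argument serves [Y] and [Z]. *)
have XE : X = a u *: heis_gens q u.
  apply: lin_form_single => s /arrXZ/(_ dv).
  by rewrite (arrXZ _ _ au dv) => /nxt_inj.
have YE : Y = b w *: heis_gens q w.
  apply: lin_form_single => s /arrYX/(_ au).
  by rewrite (arrYX _ _ bw au) => /nxt_inj.
have ZE : Z = d v *: heis_gens q v.
  apply: lin_form_single => s /arrZY/(_ bw).
  by rewrite (arrZY _ _ dv bw) => /nxt_inj.
have strip (k l c : K) (s t : heis n q) : k != 0 -> l != 0 ->
    (k *: s) * (l *: t) = c *: ((l *: t) * (k *: s)) -> s * t = c *: (t * s).
  move=> k0 l0; rewrite -!scalerAl -!scalerAr !scalerA => E.
  apply: (scalerI (mulf_neq0 k0 l0)); rewrite E scalerA; congr (_ *: _).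
  by ring.
(* Equality would force z_i = 0 by the relation for x_i y_i. *)
have noxy (i : 'I_n) :
    heis_x q i * heis_y q i != q^-1 *: (heis_y q i * heis_x q i).
  apply/eqP => E; have /eqP[] := heis_gens_neq0 (gen_z i).
  apply: (addrI (q^-1 *: (heis_y q i * heis_x q i))).
  by rewrite addr0 -[RHS]E heis_xy.
have vE := arrXZ _ _ au dv; have wE := arrZY _ _ dv bw.
rewrite {}vE in dv ZE wE; rewrite {}wE in bw YE.
(* The generator in [X] fixes the rotation. For x_i, the relation for XY determines the scalar of
   [Z]. For y_i the relation XZ = q ZX, and for z_i the relation YZ = q^-1 ZY, contradicts
   [noxy]. *)
clear arrXZ arrZY arrYX; elim/gen_ind: u => i /= in au bw dv XE YE ZE *.
- exists i, (a (gen_x i)), (b (gen_y i)); split => //.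
  have XYE : X * Y = (a (gen_x i) * b (gen_y i)) *: (heis_x q i * heis_y q i).
    by rewrite XE YE -scalerAl -scalerAr scalerA.
  have YXE : Y * X = (a (gen_x i) * b (gen_y i)) *: (heis_y q i * heis_x q i).
    by rewrite XE YE -scalerAl -scalerAr scalerA mulrC.
  apply: (addrI (q^-1 *: (Y * X))); rewrite -XY XYE YXE heis_xy scalerDr.
  by rewrite !scalerA mulrC.
- have E : heis_y q i * heis_x q i = q *: (heis_x q i * heis_y q i).
    by apply: (strip _ _ _ _ _ au dv); rewrite -XE -ZE.
  by have := noxy i; rewrite E scalerA mulVf // scale1r eqxx.
- suff E : heis_x q i * heis_y q i = q^-1 *: (heis_y q i * heis_x q i).
    by have := noxy i; rewrite E eqxx.
  by apply: (strip _ _ _ _ _ bw dv); rewrite -YE -ZE.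
Qed.

End RegularRepresentation.

(** * Products of commuting factors and the degree-one part *)

Lemma prod_delta (R : pzRingType) (n : nat) (g : 'I_n -> R) (j : 'I_n) :
  \prod_(i < n) g i ^+ (i == j) = g j.
Proof.
transitivity (\prod_(i < n | i == j) g i); last exact: big_pred1_eq.
by rewrite [RHS]big_mkcond; apply: eq_bigr => i _; case: (i == j).
Qed.

(** The ring need not be commutative, so the product depends on a list order; commuting factors are
    moved to the front one at a time. *)
Lemma prod_perm_comm (R : pzRingType) (n : nat) (g : 'I_n -> R) (s : 'S_n) :
  (forall i j, GRing.comm (g i) (g j)) ->
  \prod_(i < n) g (s i) = \prod_(i < n) g i.
Proof.
move=> gC.
have perm_prod (r1 r2 : seq 'I_n) : perm_eq r1 r2 ->
    \prod_(i <- r1) g i = \prod_(i <- r2) g i.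
  elim: r1 r2 => [|i r1 IH] r2; first by rewrite perm_sym => /perm_nilP ->.
  move=> r12.
  have ir2 : i \in r2 by rewrite -(perm_mem r12) mem_head.
  case/splitPr: ir2 r12 => r3 r4 r12.
  have gi : g i * \prod_(k <- r3) g k = \prod_(k <- r3) g k * g i.
    by apply: commr_prod => k _; apply: gC.
  rewrite big_cat !big_cons /= mulrA -gi -mulrA -big_cat.
  congr (_ * _); apply: IH; rewrite -(perm_cons i) (perm_trans r12) //.
  exact: (permEl (perm_catCA r3 [:: i] r4)).
rewrite -(big_map s xpredT g) /=; apply: perm_prod.
have us : uniq (map s (index_enum 'I_n)).
  by rewrite map_inj_uniq ?index_enum_uniq //; exact: perm_inj.
apply: uniq_perm => // [|i]; first exact: index_enum_uniq.
rewrite mem_index_enum; apply/mapP; exists ((s^-1)%g i); rewrite ?permKV //.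
exact: mem_index_enum.
Qed.

Section Graded.
Variables (K : fieldType) (n : nat) (q : K).
Local Notation G := (heis_gen n).
Local Notation H := (heis n q).

Lemma gen_eqE (i j : 'I_n) : ((gen_x i == gen_x j) = (i == j)) *
  ((gen_y i == gen_y j) = (i == j)) * ((gen_z i == gen_z j) = (i == j)).
Proof. by []. Qed.

Definition expo_gen (s : G) : expo n * expo n * expo n :=
  ([ffun i => (gen_z i == s) : nat], [ffun i => (gen_y i == s) : nat],
   [ffun i => (gen_x i == s) : nat]).

Lemma pbw_expo_gen s : pbw q (expo_gen s) = heis_gens q s.
Proof.
rewrite /pbw /=; elim/gen_ind: s => j.
- rewrite [X in X * _ * _]big1 ?[X in _ * X * _]big1 ?mul1r;
    try by move=> i _; rewrite ffunE.
  rewrite -[RHS](prod_delta (heis_x q)).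
  by apply: eq_bigr => i _; rewrite ffunE.
- rewrite [X in X * _ * _]big1 ?[X in _ * X]big1 ?mul1r ?mulr1;
    try by move=> i _; rewrite ffunE.
  rewrite -[RHS](prod_delta (heis_y q)).
  by apply: eq_bigr => i _; rewrite ffunE.
- rewrite [X in _ * X * _]big1 ?[X in _ * X]big1 ?mulr1;
    try by move=> i _; rewrite ffunE.
  rewrite -[RHS](prod_delta (heis_z q)).
  by apply: eq_bigr => i _; rewrite ffunE.
Qed.

Lemma pbw_deg_expo_gen s : pbw_deg (expo_gen s) = 1%N.
Proof.
rewrite /pbw_deg (bigD1 (gen_index s)) //= big1 ?addn0 => [|i].
  by elim/gen_ind: s => j; rewrite !ffunE /= eqxx.
elim/gen_ind: s => j /= /negPf ij; rewrite !ffunE /=.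
all: by rewrite gen_eqE ij.
Qed.

Lemma pbw_deg1P (m : expo n * expo n * expo n) :
  pbw_deg m = 1%N -> exists s, m = expo_gen s.
Proof.
case: m => [[a b] c]; rewrite /pbw_deg /= => m1.
have [i mi] : exists i, (a i + b i + c i != 0)%N.
  apply/existsP; apply: contraPT m1; rewrite negb_exists => /forallP m0.
  by rewrite big1 // => i _; have := m0 i; rewrite negbK => /eqP.
move: m1; rewrite (bigD1 i) //= => m1.
have ac : (a i + b i + c i = 1)%N by lia.
have m0 j : j != i -> [/\ a j = 0, b j = 0 & c j = 0]%N.
  move=> ji; move: m1; rewrite ac => -[]/eqP; rewrite sum_nat_eq0.
  move/forallP/(_ j)/implyP/(_ ji); rewrite !addn_eq0.
  by case/andP => /andP[/eqP-> /eqP->] /eqP->.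
have : [\/ [/\ a i = 1, b i = 0 & c i = 0]%N, [/\ a i = 0, b i = 1 & c i = 0]%N
         | [/\ a i = 0, b i = 0 & c i = 1]%N].
  by case: (a i) (b i) (c i) ac => [|[|?]] [|[|?]] [|[|?]] //; constructor.
case=> -[ai bi ci]; [exists (gen_z i)|exists (gen_y i)|exists (gen_x i)].
all: by congr (_, _, _); apply/ffunP => j; rewrite ffunE /=;
  have [->|ji] := eqVneq j i; rewrite ?eqxx //; have [aj bj cj] := m0 _ ji;
  rewrite ?aj ?bj ?cj; rewrite ?gen_eqE ?(negPf ji).
Qed.

Lemma heis_deg_gens s : heis_deg 1 (heis_gens q s : H).
Proof.
exists [:: (1, expo_gen s)]; first by rewrite /= pbw_deg_expo_gen.
by rewrite big_seq1 scale1r pbw_expo_gen.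
Qed.

Lemma heis_deg1_lin_form (u : H) : heis_deg 1 u -> exists a, u = lin_form q a.
Proof.
case=> t; elim: t u => [|[c m] t IH] u /=.
  move=> _ ->; exists (fun=> 0); rewrite big_nil /lin_form big1 // => s _.
  by rewrite scale0r.
case/andP => /eqP/pbw_deg1P[s ->] td ->; have [a aE] := IH _ td erefl.
rewrite big_cons aE /= pbw_expo_gen.
exists (fun s' => c * (s' == s)%:R + a s'); rewrite /lin_form.
under [RHS]eq_bigr do rewrite scalerDl.
rewrite big_split /=; congr (_ + _).
rewrite (bigD1 s) //= eqxx mulr1 big1 ?addr0 //.
by move=> s' /negPf ->; rewrite mulr0 scale0r.
Qed.

End Graded.

Lemma mulrZZ (K : pzRingType) (A : algType K) (a b : K) (v w : A) :
  (a *: v) * (b *: w) = (a * b) *: (v * w).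
Proof. by rewrite -scalerAl -scalerAr scalerA. Qed.

(** * From the semidirect product to graded automorphisms *)

Section TorusSymAction.
Variables (K : fieldType) (n : nat) (q : K).
Local Notation G := (heis_gen n).
Local Notation H := (heis n q).
Local Notation TS := (torus_sym K n).

Definition weight (u : TS) (s : G) : K :=
  match s with
  | inl (inl i) => mulgrp_val ((sd_normal u).1 i)
  | inl (inr i) => mulgrp_val ((sd_normal u).2 i)
  | inr i => mulgrp_val ((sd_normal u).1 i) * mulgrp_val ((sd_normal u).2 i)
  end.

Definition perm_gen (p : symgrp n) (s : G) : G :=
  match s with
  | inl (inl i) => gen_x (p i) | inl (inr i) => gen_y (p i)
  | inr i => gen_z (p i)
  end.

(** The permutation acts first and the rescaling second, so the weight is taken at the permuted
    generator. This is a relation because the map itself is only obtained by choice later. *)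
Definition realizes (u : TS) (f : H -> H) : Prop :=
  [/\ linear f, monoid_morphism f & forall s,
      f (heis_gens q s) = weight u (perm_gen (sd_compl u) s) *:
        heis_gens q (perm_gen (sd_compl u) s)].

Lemma realizes_ex u : exists f, realizes u f.
Proof.
pose Gu s : H := weight u (perm_gen (sd_compl u) s) *:
  heis_gens q (perm_gen (sd_compl u) s).
have [] := @heis_lift K n q H Gu; last by move=> f [lf mf fG]; exists f.
- move=> s t st; rewrite /Gu !mulrZZ mulrC heis_gensC //.
  have idx p r : gen_index (perm_gen p r) = p (gen_index r).
    by elim/gen_ind: r.
  by rewrite !idx (inj_eq (@perm_inj _ (sd_compl u))).
- by move=> i; rewrite /Gu !mulrZZ /= heis_xz !scalerA; congr (_ *: _); ring.
- by move=> i; rewrite /Gu !mulrZZ /= heis_yz !scalerA; congr (_ *: _); ring.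
- move=> i; rewrite /Gu !mulrZZ /= heis_xy scalerDr !scalerA.
  by congr (_ *: _ + _); ring.
Qed.

Lemma realizes_eq u f g : realizes u f -> realizes u g -> f =1 g.
Proof.
move=> [lf mf fG] [lg mg gG]; apply: heis_morph_ext => // s.
by rewrite fG gG.
Qed.

Lemma realizes_id : realizes 1%g id.
Proof.
split=> // s; have -> : perm_gen (sd_compl (1%g : TS)) s = s.
  change (perm_gen 1%g s = s).
  by elim/gen_ind: s => i; rewrite /perm_gen /gen_x /gen_y /gen_z symgrp1E.
by elim/gen_ind: s => i /=; rewrite !ffunE /= ?mul1r scale1r.
Qed.

Lemma linear_scale (f : H -> H) c v : linear f -> f (c *: v) = c *: f v.
Proof.
move=> lf; pose L : {linear H -> H} := HB.pack f
  (GRing.isLinear.Build K H H *:%R f lf).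
by rewrite -[f]/(L : H -> H) linearZ.
Qed.

(** Moving the rescaling of [v] past the permutation of [u] permutes its coordinates, which is
    exactly the twist in the semidirect product. *)
Lemma realizes_comp u v f g : realizes u f -> realizes v g ->
  realizes (u * v)%g (f \o g).
Proof.
move=> [lf [f1 fM] fG] [lg [g1 gM] gG]; split=> [||s] /=.
- by move=> c x y /=; rewrite lg lf.
- by split=> [|x y] /=; rewrite ?g1 ?f1 ?gM ?fM.
rewrite gG linear_scale // fG scalerA.
have -> : perm_gen (sd_compl (u * v)%g) s =
    perm_gen (sd_compl u) (perm_gen (sd_compl v) s).
  change (perm_gen (sd_compl u * sd_compl v)%g s =
    perm_gen (sd_compl u) (perm_gen (sd_compl v) s)).
  by elim/gen_ind: s => i; rewrite /perm_gen /gen_x /gen_y /gen_z symgrpME.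
congr (_ *: _); elim/gen_ind: s => i /=; rewrite !ffunE /= !symgrpVK //=.
- by rewrite mulrC.
- by rewrite mulrC.
- by rewrite mulrC mulrACA.
Qed.

(** A PBW monomial goes to a multiple of a PBW monomial of the same degree: the z, y and x blocks
    keep their order, and inside a block the permuted factors commute and can be sorted again. *)
Lemma realizes_deg u f d x : realizes u f -> heis_deg d x -> heis_deg d (f x).
Proof.
move=> [lf [f1 fM] fG] [s sd ->].
pose L : {linear H -> H} := HB.pack f (GRing.isLinear.Build K H H *:%R f lf).
have fX y k : f (y ^+ k) = f y ^+ k.
  by elim: k => [|k IH]; rewrite ?expr0 ?f1 // !exprS fM IH.
have fprod (g : 'I_n -> H) : f (\prod_i g i) = \prod_i f (g i).
  exact: (big_morph f fM f1).
pose p := sd_compl u.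
(* The exponent at i moves to p i, hence the inverse. *)
pose mp (m : expo n) : expo n := [ffun i => m ((p^-1)%g i)].
have block (r : 'I_n -> G) (m : expo n) :
    (forall i, perm_gen p (r i) = r (p i)) -> (forall i, gen_index (r i) = i) ->
    exists c : K, f (\prod_(i < n) heis_gens q (r i) ^+ m i) =
      c *: \prod_(i < n) heis_gens q (r i) ^+ mp m i.
  move=> rp ri; exists (\prod_i weight u (r (p i)) ^+ m i).
  have rC i j : GRing.comm (heis_gens q (r i)) (heis_gens q (r j)).
    by have [->|ij] := eqVneq i j; [|apply: heis_gensC; rewrite !ri].
  rewrite fprod.
  rewrite -(@prod_perm_comm _ _ (fun i => heis_gens q (r i) ^+ mp m i) p);
    last by move=> i j; apply: commrX; apply/commr_sym; apply: commrX.
  rewrite -scaler_prod.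
  by apply: eq_bigr => i _; rewrite fX fG rp exprZn ffunE symgrpVK.
rewrite -[f _]/(L _) linear_sum big_seq.
apply: (big_ind (@heis_deg K n q d)); [exact: heis_deg0|exact: heis_degD|].
move=> [c [[a b] e]] /(allP sd)/eqP /= abe.
rewrite linear_scale //; apply: heis_degZ.
have [ca Ea] := block (@gen_z n) a (fun=> erefl) (fun=> erefl).
have [cb Eb] := block (@gen_y n) b (fun=> erefl) (fun=> erefl).
have [ce Ee] := block (@gen_x n) e (fun=> erefl) (fun=> erefl).
have -> : f (pbw q (a, b, e)) = (ca * cb * ce) *: pbw q (mp a, mp b, mp e).
  rewrite /pbw /= !fM [X in X * _ * _]Ea [X in _ * X * _]Eb [X in _ * X]Ee.
  by rewrite !mulrZZ.
apply: heis_degZ; exists [:: (1, (mp a, mp b, mp e))]; last first.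
  by rewrite big_seq1 scale1r.
rewrite /= andbT -abe /pbw_deg (reindex_inj (@perm_inj _ p)) /=.
by apply/eqP/eq_bigr => i _; rewrite !ffunE symgrpVK.
Qed.

(** A map realizing [u^-1] is a two-sided inverse, because both composites realize 1 and so agree
    with the identity by [realizes_eq]. *)
Lemma realizes_graded u f : realizes u f -> is_graded_aut f.
Proof.
move=> uf; have [lf mf _] := uf.
have [g vg] := realizes_ex u^-1%g; split=> //; last first.
  by move=> d x; apply: realizes_deg uf.
exists g => x.
  have := realizes_comp vg uf; rewrite mulVg.
  by move/realizes_eq/(_ realizes_id)/(_ x).
have := realizes_comp uf vg; rewrite mulgV.
by move/realizes_eq/(_ realizes_id)/(_ x).
Qed.

(** The realizing maps are selected by choice; as each is determined by its values on the
    generators, the selection is automatically multiplicative. *)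
Lemma torus_sym_aut : exists F : {multiplicative TS -> graded_aut n q},
  forall u, realizes u (F u).
Proof.
have [F0 F0P] := boolp.choice realizes_ex.
pose F u : graded_aut n q := GradedAut (asboolT (realizes_graded (F0P u))).
have FM : {morph F : u v / (u * v)%g}.
  move=> u v; apply: graded_aut_eq => x.
  exact: (realizes_eq (F0P (u * v)%g) (realizes_comp (F0P u) (F0P v))).
by exists (HB.pack_for {multiplicative TS -> graded_aut n q} F
  (monoid.isMultiplicative.Build TS (graded_aut n q) F FM)).
Qed.

End TorusSymAction.

(** * Every graded automorphism comes from a unique element of the semidirect product *)

Lemma graded_aut_realized (K : fieldType) (n : nat) (q : K)
    (f : graded_aut n q) : q != 0 -> q ^+ 2 != 1 -> exists u, realizes u f.
Proof.
move=> q0 q2; have [lf [f1 fM] bf df] := graded_autP f.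
have fI := bij_inj bf.
have fZ c v : f (c *: v) = c *: f v by apply: linear_scale.
have fD v w : f (v + w) = f v + f w.
  by have := lf 1 v w; rewrite !scale1r.
have fg s : exists a, f (heis_gens q s) = lin_form q a.
  by apply: heis_deg1_lin_form; apply: df; apply: heis_deg_gens.
have f0 s : f (heis_gens q s) != 0.
  apply: contraNneq (heis_gens_neq0 q0 q2 s) => f0; apply/eqP/fI.
  by rewrite f0 -[in RHS](scale0r 0) fZ scale0r.
have /boolp.choice[jAB jABP] (i : 'I_n) :
  exists t : 'I_n * (mulgrp K * mulgrp K),
    [/\ f (heis_x q i) = mulgrp_val t.2.1 *: heis_x q t.1,
        f (heis_y q i) = mulgrp_val t.2.2 *: heis_y q t.1 &
        f (heis_z q i) = (mulgrp_val t.2.1 * mulgrp_val t.2.2) *: heis_z q t.1].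
  have [a aE] := fg (gen_x i); have [b bE] := fg (gen_y i).
  have [d dE] := fg (gen_z i).
  have [||||||j [A [B [A0 B0 EA EB EZ]]]] :=
    @heis_linear_triple K n q q0 q2 a b d.
  - by rewrite -aE.
  - by rewrite -bE.
  - by rewrite -dE.
  - by rewrite -aE -dE -!fM -fZ; congr (f _); exact: heis_xz.
  - by rewrite -bE -dE -!fM -fZ; congr (f _); exact: heis_yz.
  - by rewrite -aE -bE -dE -!fM -fZ -fD; congr (f _); exact: heis_xy.
  exists (j, (MulGrp A0, MulGrp B0)) => /=.
  by rewrite -EA -EB -EZ -aE -bE -dE.
pose j i := (jAB i).1.
(* If i and k had the same target, x_i and x_k would have proportional images, hence be proportional
   themselves by injectivity of [f]. *)
have jI : injective j.
  move=> i k jik; have [xi _ _] := jABP i; have [xk _ _] := jABP k.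
  move: xi xk; rewrite -/(j i) -/(j k) -jik.
  set A := mulgrp_val _; set B := mulgrp_val _ => xi xk.
  have /fI E : f (B *: heis_x q i) = f (A *: heis_x q k).
    by rewrite !fZ xi xk !scalerA mulrC.
  have B0 : B != 0 by apply: mulgrp_neq0.
  by have [[]] := @heis_gens_scale_inj K n q q0 q2 B A (gen_x i) (gen_x k) B0 E.
pose p : symgrp n := perm jI.
(* Weights are indexed by the target generator, so the scalar found at i is stored at p i. *)
pose A := [ffun k => (jAB ((p^-1)%g k)).2.1].
pose B := [ffun k => (jAB ((p^-1)%g k)).2.2].
have pE i : p i = j i by apply: permE.
exists (SemiDirect (A, B) p : torus_sym K n); split=> // s.
elim/gen_ind: s => i; have [xE yE zE] := jABP i.
- by rewrite /= ffunE symgrpVK pE; exact: xE.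
- by rewrite /= ffunE symgrpVK pE; exact: yE.
- by rewrite /= !ffunE symgrpVK pE; exact: zE.
Qed.

(** Each generator goes to a nonzero multiple of a generator, from which the permutation and the
    scalars can be read off. *)
Lemma realizes_inj (K : fieldType) (n : nat) (q : K) (u v : torus_sym K n)
    (f : heis n q -> heis n q) :
  q != 0 -> q ^+ 2 != 1 -> realizes u f -> realizes v f -> u = v.
Proof.
move=> q0 q2 [_ _ uf] [_ _ vf].
have uv s : perm_gen (sd_compl u) s = perm_gen (sd_compl v) s /\
    weight u (perm_gen (sd_compl u) s) = weight v (perm_gen (sd_compl u) s).
  have := uf s; rewrite vf.
  have w0 : weight v (perm_gen (sd_compl v) s) != 0.
    by elim/gen_ind: s => i /=; rewrite ?mulf_neq0 ?mulgrp_neq0.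
  by move/(heis_gens_scale_inj q0 q2 w0) => [-> ->].
case: u v uv {uf vf} => [[A B] p] [[A' B'] p'] uv.
have <- : p = p' by apply/permP => i; have [[]] := uv (gen_x i).
have pK i : p ((p^-1)%g i) = i by exact: (permKV p i).
congr (SemiDirect (_, _) _); apply/ffunP => i; apply: val_inj.
  by have [_] := uv (gen_x ((p^-1)%g i)); rewrite /= pK.
by have [_] := uv (gen_y ((p^-1)%g i)); rewrite /= pK.
Qed.

Theorem theorem4p4 (R : realType) (n : nat) (hn : (0 < n)%N) (q : R[i])
    (hq0 : q != 0) (hq : forall m : nat, (0 < m)%N -> q ^+ m != 1) :
  exists f : {multiplicative torus_sym R[i] n -> graded_aut n q},
    [/\ bijective f,
        (forall (A B : {ffun 'I_n -> mulgrp R[i]}) (i : 'I_n),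
          let phi := f (SemiDirect (A, B) 1%g) in
          [/\ phi (heis_x q i) = mulgrp_val (A i) *: heis_x q i,
              phi (heis_y q i) = mulgrp_val (B i) *: heis_y q i &
              phi (heis_z q i) = (mulgrp_val (A i) * mulgrp_val (B i)) *: heis_z q i])
      & (forall (s : symgrp n) (i : 'I_n),
          let phi := f (SemiDirect 1%g s) in
          [/\ phi (heis_x q i) = heis_x q (s i),
              phi (heis_y q i) = heis_y q (s i) &
              phi (heis_z q i) = heis_z q (s i)])].
Proof.
have q2 : q ^+ 2 != 1 by apply: hq.
have [F FP] := torus_sym_aut n q.
exists F; split.
- have F_inj : injective F.
    move=> u v Fuv; apply: (realizes_inj hq0 q2 (FP u)); rewrite Fuv; exact: FP.
  (* Surjectivity: a map realized by [u] coincides with [F u], and choosing such a [u] for each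
     automorphism gives the inverse of [F]. *)
  have /boolp.choice[g gP] (f : graded_aut n q) : exists u, F u = f.
    have [u uf] := graded_aut_realized f hq0 q2; exists u.
    by apply: graded_aut_eq; apply: realizes_eq (FP u) uf.
  by exists g => [u|//]; apply: F_inj; rewrite gP.
- move=> A B i phi; have [_ _ E] := FP (SemiDirect (A, B) 1%g).
  have id1 : (1%g : symgrp n) i = i := symgrp1E i.
  split; [have := E (gen_x i)|have := E (gen_y i)|have := E (gen_z i)];
    by rewrite /= id1.
- move=> s i phi; have [_ _ E] := FP (SemiDirect 1%g s).
  split; [have := E (gen_x i)|have := E (gen_y i)|have := E (gen_z i)];
    by rewrite /= ffunE /= ?ffunE ?mul1r scale1r.
Qed.
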